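(* Let $\varphi$ be a function of $\ell$ and let $w\in(0,\infty)^\ell$. Suppose that for every cache size $k$ there is a $\varphi(\ell)$-competitive randomized algorithm for weighted interleaved myopic paging (WIMP) with $\ell$ weight classes of weights $w_1,\dots,w_\ell$. Then there is an $O(\varphi(\ell))$-competitive online algorithm for the strict allocation problem in dimension $\ell$ with weights $w$ (the constant in $O(\cdot)$ being absolute).
   Context: Allocation problem in dimension $\ell$ with weights $w$: an algorithm maintains $x(t)\in\Delta^{\ell-1}=\{x\in[0,1]^\ell:\sum_i x_i=1\}$. At each time $t=1,2,\dots$ a direction $r_t\in\{1,\dots,\ell\}$ and a non-increasing $f_t:[0,1]\to\mathbb{R}_{\ge 0}\cup\{\infty\}$ are revealed; the algorithm moves from $x(t-1)$ to $x(t)$ knowing only data revealed so far, paying $\sum_i w_i|x_i(t)-x_i(t-1)|+f_t(x_{r_t}(t))$. In the strict allocation problem each $f_t$ is a strict threshold: for some $c_t\in[0,1]$, $f_t(z)=\infty$ if $z<c_t$ and $f_t(z)=0$ otherwise (so the algorithm must ensure $x_{r_t}(t)\ge c_t$). Weighted paging: pages with weights, cache size $k$, requested page must be in cache after each request, loading page $p$ costs $w_p$; weight class $j$ consists of pages of weight $w_j$, and each class contains arbitrarily many pages. WIMP: when serving request $t$, the algorithm knows the past requests and, for each pair of pages in the same weight class, which is requested next earlier, and nothing else about the future. Competitive ratio $\rho$: (expected) cost at most $\rho\cdot\mathrm{OPT}+b$ for some $b$ independent of the request sequence. *)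

(* Defs.v *)
From HB Require Import structures.
From mathcomp Require Import all_boot all_order all_algebra finmap.
From mathcomp Require Import all_classical all_reals all_analysis.
Set Implicit Arguments. Unset Strict Implicit. Unset Printing Implicit Defensive.
Import Order.TTheory GRing.Theory Num.Theory.
Local Open Scope ring_scope.


(* A page of weight class j is a pair (j, n): each class has infinitely many
   pages. *)
Definition page (l : nat) := ('I_l * nat)%type.

(* Requests are 0-indexed: request i of s is [onth s i].
   [next_req s i p] = offset (in [drop i.+1 s]) of the next request of p
   strictly after request i; if p is never requested again it is
   [size (drop i.+1 s)], strictly larger than all offsets of pages that are
   requested again, and equal for all pages never requested again. *)
Definition next_req (T : eqType) (s : seq T) (i : nat) (p : T) : nat :=
  find (pred1 p) (drop i.+1 s).

Definition wimp_info_eq (l : nat) (s s' : seq (page l)) (i : nat) : Prop :=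
  take i.+1 s = take i.+1 s' /\
  forall p q : page l, p.1 = q.1 ->
    (next_req s i p < next_req s i q)%N = (next_req s' i p < next_req s' i q)%N.

(* A cache trajectory C (C i = cache after serving request i) serves s with
   cache size k. The initial cache is empty. *)
Definition paging_feasible (l k : nat) (s : seq (page l))
    (C : nat -> {fset page l}) : Prop :=
  forall i, (i < size s)%N ->
    (#|` C i| <= k)%N /\ (forall p, onth s i = Some p -> p \in C i).

Definition prev_cache (l : nat) (C : nat -> {fset page l}) (i : nat)
  : {fset page l} := if i is j.+1 then C j else fset0%fset.

Definition paging_cost (R : realType) (l : nat) (w : 'I_l -> R) (n : nat)
    (C : nat -> {fset page l}) : R :=
  \sum_(i < n) \sum_(p <- (C i `\` prev_cache C i)%fset) w p.1.

Definition wimp_det_alg (l k : nat) (A : seq (page l) -> nat -> {fset page l})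
  : Prop :=
  (forall s, paging_feasible k s (A s)) /\
  (forall s s' i, (i < size s)%N -> wimp_info_eq s s' i -> A s i = A s' i).

(* A randomized WIMP algorithm is a random choice (on an arbitrary probability
   space) of a deterministic WIMP algorithm. It is rho-competitive if
   E[cost] <= rho * OPT + b for every request sequence, i.e. (unfolding the
   infimum OPT) E[cost] <= rho * cost(C) + b for every offline feasible C. *)
Definition wimp_competitive (R : realType) (l k : nat) (w : 'I_l -> R) (rho : R)
  : Prop :=
  exists (d : measure_display) (Omega : measurableType d)
         (P : probability Omega R)
         (A : Omega -> seq (page l) -> nat -> {fset page l}) (b : R),
    (forall om, wimp_det_alg k (A om)) /\
    (forall s, measurable_fun setT (fun om => paging_cost w (size s) (A om s))) /\
    (forall s (C : nat -> {fset page l}), paging_feasible k s C ->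
       (\int[P]_om (paging_cost w (size s) (A om s))%:E
          <= (rho * paging_cost w (size s) C + b)%:E)%E).

Definition in_simplex (R : realType) (l : nat) (x : 'I_l -> R) : Prop :=
  (forall i, 0 <= x i <= 1) /\ \sum_i x i = 1.

(* A strict-threshold request (r, c): the state must satisfy x r >= c. *)
Definition valid_reqs (R : realType) (l : nat) (rs : seq ('I_l * R)) : bool :=
  all (fun rc => 0 <= rc.2 <= 1) rs.

Definition move_cost (R : realType) (l : nat) (w : 'I_l -> R)
    (x y : 'I_l -> R) : R :=
  \sum_i w i * `|y i - x i|.

Definition alloc_cost (R : realType) (l : nat) (w : 'I_l -> R)
    (x : nat -> 'I_l -> R) (n : nat) : R :=
  \sum_(t < n) move_cost w (x t) (x t.+1).

(* An online (deterministic) allocation algorithm: X s = state after serving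
   the requests s; X [::] is the initial state x(0).  It must stay in the
   simplex and satisfy every strict threshold (otherwise it pays infinity). *)
Definition alloc_alg_ok (R : realType) (l : nat)
    (X : seq ('I_l * R) -> 'I_l -> R) : Prop :=
  (forall s, valid_reqs s -> in_simplex (X s)) /\
  (forall s r c, valid_reqs s -> 0 <= c <= 1 -> c <= X (rcons s (r, c)) r).

Definition alloc_offline_feasible (R : realType) (l : nat) (x0 : 'I_l -> R)
    (rs : seq ('I_l * R)) (y : nat -> 'I_l -> R) : Prop :=
  y 0%N = x0 /\ (forall t, (t <= size rs)%N -> in_simplex (y t)) /\
  (forall t r c, onth rs t = Some (r, c) -> c <= y t.+1 r).

(* rho-competitive: ALG <= rho * OPT + b, OPT unfolded as before. *)
Definition alloc_competitive (R : realType) (l : nat) (w : 'I_l -> R) (rho : R)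
    (X : seq ('I_l * R) -> 'I_l -> R) : Prop :=
  alloc_alg_ok X /\
  exists b : R, forall rs, valid_reqs rs ->
    forall y, alloc_offline_feasible (X [::]) rs y ->
      alloc_cost w (fun t => X (take t rs)) (size rs)
        <= rho * alloc_cost w y (size rs) + b.

(* Main.v *)
(* Fix a cache size k. A threshold x_r >= c is translated into many scans of the
   first m pages of class r, where m is about c k. In such a sequence the next
   requests of a class always come in the same order, so WIMP knows nothing that
   the past does not determine, and the average share of the cache given to each
   class is an online allocation, feasible up to O(1/k) after charging missed
   pages to the scans. Conversely an offline allocation, tracked lazily by
   integers, gives an offline cache of cost O(k) times its own. The additive
   constant still depends on k; restarting the algorithm after a history that
   nearly maximizes its regret makes it uniform in k, and a Banach limit over k
   yields an exactly feasible algorithm. *)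

Require Import Defs.
From HB Require Import structures.
From mathcomp Require Import all_boot all_order all_algebra finmap.
From mathcomp Require Import all_classical all_reals all_analysis.
From mathcomp Require Import measurable_realfun ring lra zify.
Import Order.TTheory GRing.Theory Num.Theory.
Local Open Scope classical_set_scope.
Local Open Scope ring_scope.

(** * Linear functionals below sublinear ones *)

(** The number [N] of scans may grow with [k] at no offline cost: a cache that already holds the
    first [m] pages serves all further scans for free, while a cache whose class [r] stays below [m]
    pages pays at least [w r] per scan. So [N] is taken so large that such a block pays for moving
    all [k] slots to [r] and back. The final constant 8 is a product of three factors 2: lazy
    tracking doubles the offline movement; allocation pays for decreases as well as increases,
    paging for loads only; unfilled slots are given to one lightest class, which at most doubles the
    movement. Averages over the randomness and limits over [k] are both positive normalized linear
    functionals on bounded functions. Such a functional preserves the simplex, moves the averaged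
    state by at most the averaged movement, and treats uncountably many histories at once. Besides
    fixing the additive constant, the restart allows comparison with offline solutions from any
    starting state; the limit requires this, since its initial state need not be that of any
    approximating algorithm. *)

Definition sublinear_on {R : realType} {V : lmodType R} (B : V -> Prop)
    (q : V -> R) : Prop :=
  (forall x y, B x -> B y -> q (x + y) <= q x + q y) /\
  (forall a x, 0 < a -> B x -> q (a *: x) <= a * q x).

(** One-sided homogeneity, applied to [a] and to its inverse, gives equality; so for the infima
    built below only the easy inequality has to be checked. *)
Lemma sublinear_scale {R : realType} {V : lmodType R} (B : V -> Prop)
    (q : V -> R) (a : R) (x : V) :
  (forall a x y, B x -> B y -> B (a *: x + y)) -> B 0 ->
  sublinear_on B q -> 0 <= a -> B x -> q (a *: x) = a * q x.
Proof.
move=> Bl B0 [qD qZ] a0 Bx.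
have BZ b y : B y -> B (b *: y) by move=> By; rewrite -[b *: y]addr0; exact: Bl.
have q0 : q 0 = 0.
  have h1 := qD _ _ B0 B0; have h2 : q 0 <= 2^-1 * q 0.
    by have := qZ 2^-1 0; rewrite scaler0; apply=> //; rewrite invr_gt0.
  by rewrite addr0 in h1; lra.
move: a0; rewrite le_eqVlt => /predU1P[<-|a0]; first by rewrite scale0r mul0r.
apply/eqP; rewrite eq_le qZ//=.
have := qZ a^-1 (a *: x); rewrite scalerA mulVf ?gt_eqF// scale1r invr_gt0.
by move=> /(_ a0 (BZ _ _ Bx)); rewrite mulrC ler_pdivlMr// mulrC.
Qed.

Lemma sublinear_opp_le {R : realType} {V : lmodType R} (B : V -> Prop)
    (q : V -> R) (x : V) :
  (forall a x y, B x -> B y -> B (a *: x + y)) -> B 0 ->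
  sublinear_on B q -> B x -> - q (- x) <= q x.
Proof.
move=> Bl B0 qs Bx; have q0 := sublinear_scale B q 0 0 Bl B0 qs (lexx 0) B0.
rewrite scale0r mul0r in q0.
have BN : B (- x) by rewrite -scaleN1r -[_ *: _]addr0; exact: Bl.
by have := qs.1 _ _ Bx BN; rewrite subrr q0; lra.
Qed.

(* A minimal sublinear functional [q] is linear: for fixed [x] the functional
   [y |-> inf_(t >= 0) (q (y + t x) - t q x)] is sublinear and below [q], hence
   equal to [q], and [t = 1] gives [q x + q y <= q (x + y)]. *)
Lemma linear_minorant {R : realType} {V : lmodType R} (B : V -> Prop)
    (p : V -> R) :
  (forall a x y, B x -> B y -> B (a *: x + y)) -> B 0 -> sublinear_on B p ->
  exists M : V -> R,
    [/\ forall x y, B x -> B y -> M (x + y) = M x + M y,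
        forall a x, B x -> M (a *: x) = a * M x &
        forall x, B x -> M x <= p x].
Proof.
move=> Bl B0 ps.
have BD x y : B x -> B y -> B (x + y).
  by move=> Bx By; have := Bl 1 x y Bx By; rewrite scale1r.
have BZ b y : B y -> B (b *: y) by move=> By; rewrite -[b *: y]addr0; exact: Bl.
have BN y : B y -> B (- y) by rewrite -scaleN1r; exact: BZ.
pose Qp q := sublinear_on B q /\ forall x, B x -> q x <= p x.
pose Q := {q : V -> R | Qp q}.
(* The order is reversed, so that a maximal element for Zorn's lemma is a minimal functional. It is
   only a preorder, since values outside [B] are ignored. *)
pose le (q q' : Q) := `[< forall x, B x -> sval q' x <= sval q x >].
(* A lower bound common to all candidates; it keeps the infimum over a chain finite. *)
have p_low (q : Q) x : B x -> - p (- x) <= sval q x.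
  move=> Bx; case: q => q [qs qp] /=.
  apply: le_trans (sublinear_opp_le _ _ _ Bl B0 qs Bx).
  by rewrite lerN2; apply/qp/BN.
have [|||[q [qs qp]] qmax] :=
  @ZL_preorder Q (exist Qp p (conj ps (fun x _ => lexx _))) le.
- by move=> q; apply/asboolP.
- move=> q r s /asboolP qr /asboolP rs; apply/asboolP => x Bx.
  by apply: le_trans (qr x Bx); exact: rs.
- move=> A totA.
  have [[q0 Aq0]|nA] := pselect (exists q, A q); last first.
    exists (exist Qp p (conj ps (fun x _ => lexx _))) => s As.
    by case: nA; exists s.
  pose S x := [set sval q x | q in A].
  have Sinf x : B x -> has_inf (S x).
    move=> Bx; split; first by exists (sval q0 x), q0.
    by exists (- p (- x)) => _ [q Aq <-]; exact: p_low.
  have infS x q : B x -> A q -> inf (S x) <= sval q x.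
    by move=> Bx Aq; apply: ge_inf; [exact: (Sinf x Bx).2|exists q].
  have Sge x c : B x -> (forall q, A q -> c <= sval q x) -> c <= inf (S x).
    move=> Bx h; apply: lb_le_inf; first exact: (Sinf x Bx).1.
    by move=> _ [q Aq <-]; exact: h.
  have infs : sublinear_on B (fun x => inf (S x)).
    split=> [x y Bx By|a x a0 Bx].
      rewrite -lerBlDr; apply: (Sge _ _ Bx) => q1 Aq1.
      rewrite lerBlDr -lerBlDl; apply: (Sge _ _ By) => q2 Aq2.
      rewrite lerBlDl; have Bxy := BD _ _ Bx By.
      (* Two different members bound the two infima; totality of the chain replaces both by the
         smaller one, whose own subadditivity then applies. *)
      have [/asboolP h|/asboolP h] := totA _ _ Aq1 Aq2.
        apply: le_trans (infS _ _ Bxy Aq2) _.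
        apply: le_trans ((svalP q2).1.1 _ _ Bx By) _.
        by rewrite lerD2r; exact: h.
      apply: le_trans (infS _ _ Bxy Aq1) _.
      apply: le_trans ((svalP q1).1.1 _ _ Bx By) _.
      by rewrite lerD2l; exact: h.
    rewrite mulrC -ler_pdivrMr//; apply: (Sge _ _ Bx) => q Aq.
    rewrite ler_pdivrMr// mulrC.
    by apply: le_trans (infS _ _ (BZ a _ Bx) Aq) _; exact: (svalP q).1.2.
  have infp x : B x -> inf (S x) <= p x.
    by move=> Bx; apply: le_trans (infS _ _ Bx Aq0) _; exact: (svalP q0).2.
  exists (exist Qp _ (conj infs infp)) => q Aq.
  by apply/asboolP => x Bx; exact: infS.
exists q.
have qZ a x : 0 <= a -> B x -> q (a *: x) = a * q x.
  by move=> *; exact: (sublinear_scale B q).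
have qD x y : B x -> B y -> q (x + y) = q x + q y.
  move=> Bx By; apply/eqP; rewrite eq_le qs.1//=.
  pose S z := [set q (z + t *: x) - t * q x | t in [set t | 0 <= t]].
  have Blow z t : B z -> 0 <= t -> - q (- z) <= q (z + t *: x) - t * q x.
    move=> Bz t0; have := qs.1 _ _ (BD _ _ Bz (BZ t _ Bx)) (BN _ Bz).
    by rewrite addrC addKr qZ//; lra.
  have Sinf z : B z -> has_inf (S z).
    move=> Bz; split; first by exists (q (z + 0 *: x) - 0 * q x), 0 => /=.
    by exists (- q (- z)) => _ [t t0 <-]; exact: Blow.
  have infS z t : B z -> 0 <= t -> inf (S z) <= q (z + t *: x) - t * q x.
    by move=> Bz t0; apply: ge_inf; [exact: (Sinf z Bz).2|exists t].
  have Sge z c : B z -> (forall t, 0 <= t -> c <= q (z + t *: x) - t * q x) ->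
      c <= inf (S z).
    move=> Bz h; apply: lb_le_inf; first exact: (Sinf z Bz).1.
    by move=> _ [t t0 <-]; exact: h.
  have Sq z : B z -> inf (S z) <= q z.
    by move=> Bz; have := infS z 0 Bz (lexx 0); rewrite scale0r addr0 mul0r subr0.
  have infs : sublinear_on B (fun z => inf (S z)).
    split=> [z z' Bz Bz'|a z a0 Bz].
      rewrite -lerBlDr; apply: (Sge _ _ Bz) => t t0.
      rewrite lerBlDr -lerBlDl; apply: (Sge _ _ Bz') => t' t'0.
      rewrite lerBlDl.
      apply: le_trans (infS _ (t + t') (BD _ _ Bz Bz') (addr_ge0 t0 t'0)) _.
      have := qs.1 _ _ (BD _ _ Bz (BZ t _ Bx)) (BD _ _ Bz' (BZ t' _ Bx)).
      by rewrite addrACA -scalerDl; lra.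
    rewrite mulrC -ler_pdivrMr//; apply: (Sge _ _ Bz) => t t0.
    rewrite ler_pdivrMr//.
    apply: le_trans (infS _ (a * t) (BZ a _ Bz) (mulr_ge0 (ltW a0) t0)) _.
    rewrite -scalerA -scalerDr qZ ?(ltW a0)//; last exact/BD/BZ.
    by rewrite le_eqVlt; apply/orP; left; apply/eqP; ring.
  have infp z : B z -> inf (S z) <= p z.
    by move=> Bz; apply: le_trans (Sq _ Bz) _; exact: (qp z Bz).
  have /asboolP/= qle := qmax (exist Qp _ (conj infs infp))
    (introT (asboolP _) Sq).
  have := le_trans (qle y By) (infS y 1 By ler01).
  by rewrite scale1r mul1r [y + x]addrC; lra.
have q0 : q 0 = 0 by have := qZ 0 0 (lexx 0) B0; rewrite scaler0 mul0r.
have qN x : B x -> q (- x) = - q x.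
  move=> Bx; apply/eqP; rewrite -addr_eq0 -qD//; last exact: BN.
  by rewrite addNr q0.
split=> // a x Bx.
have [a0|a0] := leP 0 a; first exact: qZ.
rewrite -[a]opprK scaleNr qN; last exact: BZ.
have na0 : 0 <= - a by rewrite oppr_ge0 ltW.
by rewrite (qZ _ _ na0 Bx) -mulNr.
Qed.

(** * Means on bounded functions *)

Definition bounded_fct {R : realType} {T : Type} (f : T -> R) : Prop :=
  exists K, forall t, `|f t| <= K.

(** A finitely additive expectation. No continuity along limits is asked, which is why it can be
    defined on all bounded functions. *)
Definition is_mean {R : realType} {T : Type} (M : (T -> R) -> R) : Prop :=
  [/\ forall f g, bounded_fct f -> bounded_fct g ->
        M (fun t => f t + g t) = M f + M g,
      forall a f, bounded_fct f -> M (fun t => a * f t) = a * M f,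
      forall f g, bounded_fct f -> bounded_fct g ->
        (forall t, f t <= g t) -> M f <= M g &
      forall c, M (fun=> c) = c].

Lemma bounded_cst {R : realType} {T : Type} (c : R) :
  bounded_fct (fun _ : T => c).
Proof. by exists `|c|. Qed.

Lemma bounded_comb {R : realType} {T : Type} (a b : R) (f g : T -> R) :
  bounded_fct f -> bounded_fct g -> bounded_fct (fun t => a * f t + b * g t).
Proof.
move=> [K fK] [L gL]; exists (`|a| * K + `|b| * L) => t.
apply: le_trans (ler_normD _ _) _; rewrite !normrM.
by apply: lerD; exact: ler_wpM2l.
Qed.

Lemma bounded_scale {R : realType} {T : Type} (a : R) (f : T -> R) :
  bounded_fct f -> bounded_fct (fun t => a * f t).
Proof.
by move=> [K fK]; exists (`|a| * K) => t; rewrite normrM ler_wpM2l.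
Qed.

Lemma bounded_add {R : realType} {T : Type} (f g : T -> R) :
  bounded_fct f -> bounded_fct g -> bounded_fct (fun t => f t + g t).
Proof.
move=> [K fK] [L gL]; exists (K + L) => t.
by apply: le_trans (ler_normD _ _) _; exact: lerD.
Qed.

Lemma bounded_sub {R : realType} {T : Type} (f g : T -> R) :
  bounded_fct f -> bounded_fct g -> bounded_fct (fun t => f t - g t).
Proof.
move=> [K fK] [L gL]; exists (K + L) => t.
by apply: le_trans (ler_normB _ _) _; exact: lerD.
Qed.

Lemma bounded_norm {R : realType} {T : Type} (f : T -> R) :
  bounded_fct f -> bounded_fct (fun t => `|f t|).
Proof. by move=> [K fK]; exists K => t; rewrite normr_id. Qed.

Lemma bounded_sum {R : realType} {T I : Type} (s : seq I) (F : I -> T -> R) :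
  (forall i, bounded_fct (F i)) -> bounded_fct (fun t => \sum_(i <- s) F i t).
Proof.
move=> bF; elim: s => [|i s IH].
  by exists 0 => t; rewrite big_nil normr0.
have [K HK] := bounded_add _ _ (bF i) IH.
by exists K => t; rewrite big_cons.
Qed.

Lemma mean_sum {R : realType} {T I : Type} (M : (T -> R) -> R) (s : seq I)
    (F : I -> T -> R) :
  is_mean M -> (forall i, bounded_fct (F i)) ->
  M (fun t => \sum_(i <- s) F i t) = \sum_(i <- s) M (F i).
Proof.
move=> [MD MZ Mle Mc] bF; elim: s => [|i s IH].
  by under eq_fun do rewrite big_nil; rewrite big_nil Mc.
under eq_fun do rewrite big_cons.
by rewrite MD ?IH ?big_cons//; exact: bounded_sum.
Qed.

Lemma mean_sub {R : realType} {T : Type} (M : (T -> R) -> R) (f g : T -> R) :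
  is_mean M -> bounded_fct f -> bounded_fct g ->
  M (fun t => f t - g t) = M f - M g.
Proof.
move=> [MD MZ Mle Mc] bf bg.
have -> : (fun t => f t - g t) = (fun t => f t + -1 * g t).
  by apply/funext => t; rewrite mulN1r.
by rewrite MD// ?MZ// ?mulN1r//; exact: bounded_scale.
Qed.

(** Jensen's inequality for the absolute value; it bounds the movement of an averaged state by the
    average movement. *)
Lemma mean_dist {R : realType} {T : Type} (M : (T -> R) -> R) (f g : T -> R) :
  is_mean M -> bounded_fct f -> bounded_fct g ->
  `|M f - M g| <= M (fun t => `|f t - g t|).
Proof.
move=> mM bf bg; have [MD MZ Mle Mc] := mM.
have bfg := bounded_sub _ _ bf bg; have bgf := bounded_sub _ _ bg bf.
rewrite ler_norml; apply/andP; split.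
  rewrite lerNl opprB -(mean_sub M)//; apply: (Mle _ _) => // [|t].
    exact: bounded_norm.
  by rewrite distrC ler_norm.
rewrite -(mean_sub M)//; apply: (Mle _ _) => // [|t]; first exact: bounded_norm.
exact: ler_norm.
Qed.

(** Read [G g v] as a certificate that the mean of [g] is at most [v]. The best certified bound for
    a majorant of [f] is sublinear in [f], and a linear functional below it is a mean: positivity
    comes from the certificate of the constant 0, normalization from those of [c] and [- c]. *)
Lemma mean_exists {R : realType} {T : Type} (G : (T -> R) -> R -> Prop) :
  (forall g v g' v', G g v -> G g' v' -> G (fun t => g t + g' t) (v + v')) ->
  (forall a g v, 0 < a -> G g v -> G (fun t => a * g t) (a * v)) ->
  (forall c, G (fun=> c) c) ->
  (forall g v, G g v -> (forall t, 0 <= g t) -> 0 <= v) ->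
  exists2 M, is_mean M &
    forall f g v, bounded_fct f -> G g v -> (forall t, f t <= g t) -> M f <= v.
Proof.
move=> GD GZ Gc Gp.
pose S f := [set v | exists2 g, G g v & forall t, f t <= g t].
have Slow f K v : (forall t, `|f t| <= K) -> S f v -> - K <= v.
  move=> fK [g Gg fg]; have := Gp _ _ (GD _ _ _ _ Gg (Gc K)).
  rewrite -[X in X -> _]/((forall t, 0 <= g t + K) -> 0 <= v + K) -lerBlDr sub0r.
  apply=> t; have := fK t; rewrite ler_norml => /andP[+ _].
  by have := fg t; lra.
have Sinf f : bounded_fct f -> has_inf (S f).
  move=> [K fK]; split; last by exists (- K) => v; exact: Slow.
  by exists K, (fun=> K) => // t; exact: le_trans (ler_norm _) (fK t).
have infS f v : bounded_fct f -> S f v -> inf (S f) <= v.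
  by move=> bf Sv; apply: ge_inf => //; exact: (Sinf _ bf).2.
have Sge f c : bounded_fct f -> (forall v, S f v -> c <= v) -> c <= inf (S f).
  by move=> bf h; apply: lb_le_inf; first exact: (Sinf _ bf).1.
pose V : lmodType R := T -> R^o.
have [|||M [MD MZ Mp]] := @linear_minorant R V bounded_fct (fun f => inf (S f)).
- move=> a f g bf bg; have [K HK] := bounded_comb a 1 _ _ bf bg.
  by exists K => t; have := HK t; rewrite mul1r.
- exact: (bounded_cst 0).
- split=> [f g bf bg|a f a0 bf].
    have bfg : bounded_fct (f + g) by exact: bounded_add.
    rewrite -lerBlDr; apply: (Sge _ _) => // v [f' Gf' ff'].
    rewrite lerBlDr -lerBlDl; apply: (Sge _ _) => // u [g' Gg' gg'].
    rewrite lerBlDl; apply: (infS _ _) => //; exists (fun t => f' t + g' t) => [|t].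
      exact: GD.
    exact: lerD.
  rewrite mulrC -ler_pdivrMr//; apply: (Sge _ _) => // v [f' Gf' ff'].
  rewrite ler_pdivrMr// mulrC; apply: (infS _ _); first exact: bounded_scale.
  exists (fun t => a * f' t) => [|t]; first exact: GZ.
  by rewrite ler_pM2l.
have MG f g v : bounded_fct f -> G g v -> (forall t, f t <= g t) -> M f <= v.
  by move=> bf Gg fg; apply: le_trans (Mp _ bf) _; apply: (infS _ _) => //; exists g.
exists M => //; split => //.
- move=> f g bf bg fg.
  have -> : f = (g : V) + (-1 : R) *: ((g : V) - (f : V)).
    by apply/funext => t; rewrite scaleN1r opprB addrC subrK.
  have bgf : bounded_fct ((g : V) - (f : V)) by exact: bounded_sub.
  rewrite MD//; last exact: bounded_scale.
  rewrite gerDl -subr_le0 subr0.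
  apply: (MG _ (fun=> 0)) => [||t]; [exact: bounded_scale|exact: Gc|].
  change (-1 * (g t - f t) <= 0); have := fg t; lra.
- move=> c; apply/eqP; rewrite eq_le; apply/andP; split.
    by apply: (MG _ (fun=> c)) => //; exact: bounded_cst.
  have := MG (fun=> -1 * c) (fun=> -1 * c) _ (bounded_cst _) (Gc _)
    (fun=> lexx _).
  rewrite (MZ (-1) (fun=> c) (bounded_cst c)); lra.
Qed.

(* The WIMP hypothesis makes total costs measurable but not the cache contents,
   so averages of cache contents need an extension of the expectation to all
   bounded functions. *)
Lemma expectation_mean {R : realType} (d : measure_display)
    (Omega : measurableType d) (P : probability Omega R) :
  exists2 M : (Omega -> R) -> R, is_mean M &
    forall (f g : Omega -> R) v, bounded_fct f -> measurable_fun setT g ->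
      (forall om, 0 <= g om) -> (forall om, f om <= g om) ->
      (\int[P]_om (g om)%:E <= v%:E)%E -> M f <= v.
Proof.
pose G (g : Omega -> R) (v : R) :=
  P.-integrable setT (EFin \o g) /\ (\int[P]_om (g om)%:E <= v%:E)%E.
have [||||M mM MG] := @mean_exists R Omega G.
- move=> g v g' v' [ig gv] [ig' gv']; split.
    exact: (integrableD measurableT ig ig').
  under eq_integral do rewrite EFinD.
  rewrite (integralD measurableT ig ig') EFinD; exact: leeD.
- move=> a g v a0 [ig gv]; split; first exact: (integrableZl measurableT a ig).
  under eq_integral do rewrite EFinM.
  by rewrite (integralZl measurableT ig) EFinM lee_pmul2l// lte_fin.
- move=> c; split; first exact: finite_measure_integrable_cst.
  by rewrite integral_cst// [X in (_ * X)%E]probability_setT mule1.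
- move=> g v [_ gv] g0; rewrite -lee_fin; apply: le_trans gv.
  by apply: integral_ge0 => om _; rewrite lee_fin.
exists M => // f g v bf mg g0 fg gv; apply: MG bf _ fg; split=> //.
apply/integrableP; split; first exact/measurable_EFinP.
apply: le_lt_trans (ltry v); apply: le_trans gv.
by under eq_integral do rewrite /= ger0_norm//.
Qed.

(** The certificates are eventual upper bounds, so [L] lies below the limit superior. *)
Lemma banach_limit {R : realType} :
  exists2 L : (nat -> R) -> R, is_mean L &
    forall u v N, bounded_fct u -> (forall n, (N <= n)%N -> u n <= v) ->
      L u <= v.
Proof.
pose G (g : nat -> R) (v : R) :=
  exists N, forall n, (N <= n)%N -> g n <= v.
have [||||M mM MG] := @mean_exists R nat G.
- move=> g v g' v' [N gN] [N' gN']; exists (maxn N N') => n.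
  by rewrite geq_max => /andP[nN nN']; apply: lerD; [exact: gN|exact: gN'].
- move=> a g v a0 [N gN]; exists N => n nN.
  by rewrite ler_pM2l//; exact: gN.
- by move=> c; exists 0.
- by move=> g v [N gN] g0; exact: le_trans (g0 N) (gN N (leqnn N)).
exists M => // u v N bu uv; apply: (MG _ u) => //.
by exists N.
Qed.

(** * Paging sequences encoding thresholds *)

Local Open Scope nat_scope.

Definition row_pages {l : nat} (r : 'I_l) (m : nat) : seq (page l) :=
  [seq (r, j) | j <- iota 0 m].

(* [N] scans of the first [x.2] pages of class [x.1] force a competitive cache to
   hold [x.2] pages of that class. *)
Definition block {l : nat} (N : nat) (x : 'I_l * nat) : seq (page l) :=
  flatten (nseq N (row_pages x.1 x.2)).

Definition encode {l : nat} (N : nat) (s : seq ('I_l * nat)) : seq (page l) :=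
  flatten [seq block N x | x <- s].

(* Appended to every request sequence: otherwise ties between pages that are never
   requested again would reveal the future. *)
Definition all_pages (l k : nat) : seq (page l) :=
  flatten [seq row_pages r k | r <- enum 'I_l].

Definition page_seq {l : nat} (N k : nat) (s : seq ('I_l * nat)) :
  seq (page l) := encode N s ++ all_pages l k.

Lemma encode_rcons {l : nat} (N : nat) (s : seq ('I_l * nat)) x :
  encode N (rcons s x) = encode N s ++ block N x.
Proof. by rewrite /encode map_rcons flatten_rcons. Qed.

Lemma encode_cat {l : nat} (N : nat) (s t : seq ('I_l * nat)) :
  encode N (s ++ t) = encode N s ++ encode N t.
Proof. by rewrite /encode map_cat flatten_cat. Qed.

Lemma mem_row {l : nat} (r r' : 'I_l) (m a : nat) :
  ((r', a) \in row_pages r m) = (r' == r) && (a < m).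
Proof.
apply/mapP/andP => [[j + [-> ->]]|[/eqP-> am]].
  by rewrite mem_iota.
by exists a; rewrite ?mem_iota.
Qed.

Lemma size_row {l : nat} (r : 'I_l) (m : nat) : size (row_pages r m) = m.
Proof. by rewrite size_map size_iota. Qed.

Lemma index_row {l : nat} (r : 'I_l) (m a : nat) :
  a < m -> index (r, a) (row_pages r m) = a.
Proof.
move=> am; rewrite index_map => [|? ? []//].
by rewrite -{1}(add0n a) -(nth_iota 0 0 am) index_uniq ?iota_uniq ?size_iota.
Qed.

Lemma index_row_cat {l : nat} (r r' : 'I_l) (m a : nat) (v : seq (page l)) :
  index (r', a) (row_pages r m ++ v) =
  if (r' == r) && (a < m) then a else m + index (r', a) v.
Proof.
rewrite index_cat mem_row size_row; case: ifP => // /andP[/eqP-> am].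
exact: index_row.
Qed.

(** [index] agrees with [next_req] on the remaining sequence. Pages below [k] come in increasing
    order, and all others tie at the end; the right-hand side no longer mentions the future [v]. *)
Definition class_sorted {l : nat} (k : nat) (v : seq (page l)) (r : 'I_l) :=
  forall a b, (index (r, a) v < index (r, b) v) = (a < b) && (a < k).

(** A scan requests an initial segment of its class in increasing order; the pages after it keep
    their order from [v], shifted by [m]. *)
Lemma class_sorted_row {l : nat} (k m : nat) (r r' : 'I_l) (v : seq (page l)) :
  m <= k -> class_sorted k v r' -> class_sorted k (row_pages r m ++ v) r'.
Proof.
move=> mk vs a b; rewrite !index_row_cat; case: eqP => [_|_] /=; last first.
  by rewrite ltn_add2l vs.
case: (ltnP a m) => am; case: (ltnP b m) => bm.
- by rewrite (leq_trans am mk) andbT.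
- by rewrite (leq_trans am mk) andbT; lia.
- by apply/idP/idP; lia.
- by rewrite ltn_add2l vs.
Qed.

Lemma class_sorted_last_row {l : nat} (k : nat) (r : 'I_l) (v : seq (page l)) :
  (forall p, p \in v -> p.2 < k) -> class_sorted k (row_pages r k ++ v) r.
Proof.
move=> vk a b; rewrite !index_row_cat eqxx /=.
have nv c : k <= c -> index (r, c) v = size v.
  by move=> kc; apply/memNindex/negP => /vk /=; lia.
case: (ltnP a k) => ak; case: (ltnP b k) => bk; rewrite ?nv//; lia.
Qed.

Lemma class_sorted_all_pages (l k : nat) (r : 'I_l) :
  class_sorted k (all_pages l k) r.
Proof.
have : r \in enum 'I_l by rewrite mem_enum.
rewrite /all_pages; elim: (enum 'I_l) => //= r0 s IH; rewrite inE.
case: (eqVneq r r0) => [<- _|_ /= rs]; last exact/class_sorted_row/IH.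
apply: class_sorted_last_row => -[q a] /flattenP[_ /mapP[r' _ ->]].
by rewrite mem_row => /andP[].
Qed.

Lemma class_sorted_page_seq {l : nat} (N k : nat) (s : seq ('I_l * nat)) r :
  all (fun x => x.2 <= k) s -> class_sorted k (page_seq N k s) r.
Proof.
elim: s => [_|x s IH /= /andP[xk /IH {}IH]]; first exact: class_sorted_all_pages.
rewrite /page_seq /encode /= -catA -/(encode N s) -/(page_seq N k s) /block.
by elim: {1}N => //= n IHn; rewrite -catA; exact: class_sorted_row.
Qed.

Lemma ltn_index_cat {T : eqType} (u v v' : seq T) (p q : T) :
  (index p v < index q v) = (index p v' < index q v') ->
  (index p (u ++ v) < index q (u ++ v)) =
  (index p (u ++ v') < index q (u ++ v')).
Proof.
move=> H; rewrite !index_cat; case: ifP => pu; case: ifP => qu //.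
- by have := pu; rewrite -index_mem; lia.
- by have := qu; rewrite -index_mem; lia.
- by rewrite !ltn_add2l.
Qed.

(** Both futures are the same rest of [encode N s] followed by a class-sorted sequence. Pages met in
    the common rest are compared there, and all others compare as [class_sorted] dictates. *)
Lemma wimp_info_page_seq {l : nat} (N k : nat) (s t : seq ('I_l * nat)) i :
  all (fun x => x.2 <= k) (s ++ t) -> i < size (encode N s) ->
  wimp_info_eq (page_seq N k s) (page_seq N k (s ++ t)) i.
Proof.
rewrite all_cat => /andP[sk tk] iN; split.
  by rewrite /page_seq encode_cat -catA !takel_cat.
move=> [r a] [r' b] /= <-.
rewrite /next_req /page_seq encode_cat -catA !(drop_cat i.+1 (encode N s)).
have [Ni|Ni] := ltnP i.+1 (size (encode N s)); last first.
  have {iN Ni}-> : i.+1 = size (encode N s) by lia.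
  rewrite subnn !drop0.
  transitivity ((a < b) && (a < k)); first exact: class_sorted_all_pages.
  by symmetry; exact: (class_sorted_page_seq N k t r tk a b).
apply: ltn_index_cat.
transitivity ((a < b) && (a < k)); first exact: class_sorted_all_pages.
by symmetry; exact: (class_sorted_page_seq N k t r tk a b).
Qed.

(** * Loads *)

Definition class_part {l : nat} (C : {fset page l}) (i : 'I_l) : {fset page l} :=
  [fset p in C | p.1 == i]%fset.

Definition class_count {l : nat} (C : {fset page l}) (i : 'I_l) : nat :=
  #|` class_part C i|.

Lemma mem_class_part {l : nat} (C : {fset page l}) i p :
  (p \in class_part C i) = (p \in C) && (p.1 == i).
Proof. by rewrite !inE. Qed.

Lemma class_count_subU {l : nat} (A B C : {fset page l}) i :
  (forall p, p \in A -> p \in B \/ p \in C) ->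
  class_count A i <= class_count B i + class_count C i.
Proof.
move=> ABC; rewrite /class_count.
apply: (@leq_trans #|` class_part B i `|` class_part C i|%fset).
  apply: fsubset_leq_card; apply/fsubsetP => p; rewrite inE !mem_class_part.
  by case/andP => /ABC[->|->] ->; rewrite ?orbT.
by rewrite cardfsU leq_subr.
Qed.

Lemma sum_class_count {l : nat} (C : {fset page l}) :
  \sum_i class_count C i = #|` C|.
Proof.
rewrite card_fset_sum1 (partition_big (fun p : page l => p.1) predT)//=.
apply: eq_bigr => i _; rewrite /class_count card_fset_sum1.
by rewrite [RHS]big_fset_condE.
Qed.

Lemma row_le_class_count {l : nat} (C : {fset page l}) (r : 'I_l) m :
  (forall a, a < m -> (r, a) \in C) -> m <= class_count C r.
Proof.
move=> rC; rewrite -(size_row r m).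
have -> : size (row_pages r m) = #|` [fset p in row_pages r m]%fset|.
  rewrite card_fseq undup_id// map_inj_uniq ?iota_uniq//.
  by move=> ? ? [].
apply: fsubset_leq_card; apply/fsubsetP => -[q a]; rewrite mem_class_part !inE.
by rewrite mem_row /= => /andP[/eqP-> /rC->]; rewrite eqxx.
Qed.

Local Open Scope ring_scope.

Definition load {R : realType} {l : nat} (w : 'I_l -> R)
    (A B : {fset page l}) : R := \sum_(p <- (B `\` A)%fset) w p.1.

Lemma loadE {R : realType} {l : nat} (w : 'I_l -> R) (A B : {fset page l}) :
  load w A B = \sum_i w i * (class_count (B `\` A)%fset i)%:R.
Proof.
rewrite /load (partition_big (fun p : page l => p.1) predT)//=.
apply: eq_bigr => i _; rewrite /class_count card_fset_sum1 natr_sum mulr_sumr.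
rewrite -[RHS]big_fset_condE; apply: eq_bigr => p /eqP->.
by rewrite mulr1.
Qed.

(** Only increases are charged, as paging charges loads and not evictions. This asymmetric distance
    bounds the load between caches from below. *)
Definition upmove {R : realType} {l : nat} (w : 'I_l -> R) (a b : 'I_l -> nat)
  : R := \sum_i w i * (b i - a i)%N%:R.

Lemma upmove_triangle {R : realType} {l : nat} (w : 'I_l -> R)
    (b a c : 'I_l -> nat) : (forall i, 0 <= w i) ->
  upmove w a c <= upmove w a b + upmove w b c.
Proof.
move=> w0; rewrite -big_split; apply: ler_sum => i _ /=.
by rewrite -mulrDr ler_wpM2l// -natrD ler_nat; lia.
Qed.

Lemma upmove_ge0 {R : realType} {l : nat} (w : 'I_l -> R) (a b : 'I_l -> nat) :
  (forall i, 0 <= w i) -> 0 <= upmove w a b.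
Proof. by move=> w0; apply: sumr_ge0 => i _; rewrite mulr_ge0. Qed.

Lemma load_ge0 {R : realType} {l : nat} (w : 'I_l -> R) (A B : {fset page l}) :
  (forall i, 0 <= w i) -> 0 <= load w A B.
Proof. by move=> w0; apply: sumr_ge0. Qed.

Lemma load_triangle {R : realType} {l : nat} (w : 'I_l -> R)
    (B A C : {fset page l}) : (forall i, 0 <= w i) ->
  load w A C <= load w A B + load w B C.
Proof.
move=> w0; rewrite !loadE -big_split; apply: ler_sum => i _ /=.
rewrite -mulrDr ler_wpM2l// -natrD ler_nat; apply: class_count_subU => p.
by rewrite !inE => /andP[-> ->]; case: (p \in B); [left|right].
Qed.

Lemma upmove_class_count_le {R : realType} {l : nat} (w : 'I_l -> R)
    (A B : {fset page l}) : (forall i, 0 <= w i) ->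
  upmove w (class_count A) (class_count B) <= load w A B.
Proof.
move=> w0; rewrite loadE; apply: ler_sum => i _.
rewrite ler_wpM2l// ler_nat leq_subLR; apply: class_count_subU => p.
by rewrite !inE => ->; case: (p \in A); [left|right].
Qed.

Lemma load_mem {R : realType} {l : nat} (w : 'I_l -> R) (A B : {fset page l}) p :
  (forall i, 0 <= w i) -> p \notin A -> p \in B -> w p.1 <= load w A B.
Proof.
move=> w0 pA pB; rewrite /load (big_fsetD1 p) ?lerDl ?sumr_ge0//.
by rewrite !inE pA.
Qed.

Definition path_load {R : realType} {l : nat} (w : 'I_l -> R)
    (D : nat -> {fset page l}) (lo hi : nat) : R :=
  \sum_(lo <= i < hi) load w (D i) (D i.+1).

Lemma path_load_ge0 {R : realType} {l : nat} (w : 'I_l -> R) D lo hi :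
  (forall i, 0 <= w i) -> 0 <= path_load w D lo hi.
Proof. by move=> w0; apply: sumr_ge0 => i _; exact: load_ge0. Qed.

Lemma path_load_cat {R : realType} {l : nat} (w : 'I_l -> R) D lo mi hi :
  (lo <= mi)%N -> (mi <= hi)%N ->
  path_load w D lo hi = path_load w D lo mi + path_load w D mi hi.
Proof. by move=> ? ?; rewrite /path_load (big_cat_nat _ (n := mi)). Qed.

Lemma load_le_path_load {R : realType} {l : nat} (w : 'I_l -> R) D lo hi :
  (forall i, 0 <= w i) -> (lo <= hi)%N ->
  load w (D lo) (D hi) <= path_load w D lo hi.
Proof.
move=> w0; elim: hi => [|hi IH].
  rewrite leqn0 => /eqP->.
  by rewrite /load fsetDv big_seq_fset0 path_load_ge0.
rewrite leq_eqVlt => /predU1P[<-|lohi].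
  by rewrite /load fsetDv big_seq_fset0 path_load_ge0.
rewrite (@path_load_cat _ _ _ _ lo hi)// {2}/path_load big_nat1.
by apply: le_trans (load_triangle w (D hi) _ _ w0) _; rewrite lerD2r; exact: IH.
Qed.

(* If class [r] never holds [m] pages, each scan of its first [m] pages misses
   one of them. *)
Lemma path_load_scans {R : realType} {l : nat} (w : 'I_l -> R) D (r : 'I_l)
    (N m lo : nat) :
  (forall i, 0 <= w i) ->
  (forall j a, (j < N)%N -> (a < m)%N -> (r, a) \in D (lo + (j * m + a)).+1) ->
  (forall t, (lo <= t <= lo + N * m)%N -> (class_count (D t) r < m)%N) ->
  N%:R * w r <= path_load w D lo (lo + N * m).
Proof.
move=> w0; elim: N => [|N IH] Dr few; first by rewrite mul0r path_load_ge0.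
rewrite (@path_load_cat _ _ _ _ lo (lo + N * m)) ?leq_add2l ?leq_mul2r ?leqnSn
  ?orbT ?leq_addr//.
rewrite -natr1 mulrDl mul1r; apply: lerD.
  by apply: IH => [j a jN|t tN]; [apply: Dr; lia|apply: few; lia].
set t := (lo + N * m)%N.
(* At the start [t] of the last scan some page of the row is missing; it must be loaded before the
   scan has passed it. *)
have /existsNP[a /not_implyP[am ra]] :
    ~ (forall a, (a < m)%N -> (r, a) \in D t).
  by move=> /row_le_class_count; rewrite leqNgt few// /t; lia.
have ta : (t <= (t + a).+1)%N by lia.
rewrite (@path_load_cat _ _ _ _ t (t + a).+1)// /t; last by lia.
rewrite -[leLHS]addr0 lerD ?path_load_ge0//.
apply: le_trans (load_le_path_load w D _ _ w0 ta).
apply: (load_mem w _ _ (r, a)) => //; first exact/negP.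
by have := Dr N a (ltnSn N) am; rewrite addnA.
Qed.

Lemma onth_block {l : nat} (N : nat) (x : 'I_l * nat) (j a : nat) :
  (j < N)%N -> (a < x.2)%N -> onth (block N x) (j * x.2 + a) = Some (x.1, a).
Proof.
move=> jN am; rewrite /block; elim: N j jN => // N IH [|j] jN /=.
  rewrite onth_cat size_row am mul0n add0n.
  by rewrite /row_pages onth_map onthE (nth_map 0%N) ?size_iota// nth_iota.
rewrite onth_cat size_row ifN; last by rewrite -leqNgt; lia.
by rewrite mulSn -addnA addKn IH.
Qed.

Lemma size_block {l : nat} (N : nat) (x : 'I_l * nat) :
  size (block N x) = (N * x.2)%N.
Proof. by rewrite /block size_flatten /shape map_nseq sumn_nseq size_row mulnC. Qed.

Lemma onth_page_seq {l : nat} (N k : nat) (s : seq ('I_l * nat)) x (j a : nat) :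
  (j < N)%N -> (a < x.2)%N ->
  onth (page_seq N k (rcons s x)) (size (encode N s) + (j * x.2 + a)) =
  Some (x.1, a).
Proof.
move=> jN am; rewrite /page_seq encode_rcons -catA onth_cat ifN; last first.
  by rewrite -leqNgt leq_addr.
rewrite addKn onth_cat size_block ifT ?onth_block//.
by nia.
Qed.

(* Follow the cache at a moment when class [r] holds [m] pages; if there is none,
   giving all slots to class [r] is paid for by the [N] scans. *)
Lemma block_config {R : realType} {l : nat} (w : 'I_l -> R) (W : R) D k N lo hi
    (r : 'I_l) m :
  (forall i, 0 <= w i <= W) -> (k * 2)%:R * W <= N%:R * w r -> (m <= k)%N ->
  hi = (lo + N * m)%N ->
  (forall j a, (j < N)%N -> (a < m)%N -> (r, a) \in D (lo + (j * m + a)).+1) ->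
  (forall t, (lo <= t <= hi)%N -> (#|` D t| <= k)%N) ->
  exists z : 'I_l -> nat,
    [/\ (\sum_i z i <= k)%N, (m <= z r)%N &
      upmove w (class_count (D lo)) z + upmove w z (class_count (D hi)) <=
      path_load w D lo hi].
Proof.
move=> wW NW mk hiE Dr Dk; have w0 i : 0 <= w i by have /andP[] := wW i.
have wleW i : w i <= W by have /andP[] := wW i.
have W0 : 0 <= W := le_trans (w0 r) (wleW r).
have [[t /andP[tlohi mt]]|few] :=
  pselect (exists t, (lo <= t <= hi)%N && (m <= class_count (D t) r)%N).
  have /andP[lot thi] := tlohi.
  exists (class_count (D t)); rewrite sum_class_count; split=> //; first exact: Dk.
  rewrite (@path_load_cat _ _ _ _ lo t)//; apply: lerD.
    exact: le_trans (upmove_class_count_le w _ _ w0)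
      (load_le_path_load w D _ _ w0 lot).
  exact: le_trans (upmove_class_count_le w _ _ w0)
    (load_le_path_load w D _ _ w0 thi).
exists (fun i => if i == r then k else 0%N); split.
- by rewrite -big_mkcond big_pred1_eq.
- by rewrite eqxx.
have lohi : (lo <= hi)%N by rewrite hiE leq_addr.
rewrite hiE; apply: le_trans (path_load_scans w D r N m lo w0 Dr _); last first.
  move=> t tlohi; rewrite ltnNge; apply/negP => mt; apply: few; exists t.
  by rewrite hiE tlohi mt.
(* The two halves of [2 k W]: raising class [r] by at most [k] slots, and returning to a cache of at
   most [k] pages. *)
apply: le_trans NW; rewrite muln2 -addnn natrD mulrDl; apply: lerD.
  rewrite /upmove (bigD1 r)//= eqxx big1 ?addr0 => [|i ir]; last first.
    by rewrite (negbTE ir) sub0n mulr0.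
  rewrite mulrC; apply: ler_pM => //; first by rewrite ler_nat leq_subr.
apply: (@le_trans _ _ (\sum_i W * (class_count (D hi) i)%:R)).
  rewrite -hiE; apply: ler_sum => i _.
  by apply: ler_pM => //; rewrite ler_nat leq_subr.
rewrite -mulr_sumr mulrC -natr_sum sum_class_count ler_wpM2r// ler_nat.
by apply: Dk; rewrite lohi leqnn.
Qed.

Lemma prev_cache_le {l k : nat} (s : seq (page l)) C i :
  paging_feasible k s C -> (i <= size s)%N -> (#|` prev_cache C i| <= k)%N.
Proof.
case: i => [|i] Cs iN; last by have [] := Cs i iN.
have -> : #|` prev_cache C 0| = 0%N by exact: cardfs0.
exact: leq0n.
Qed.

Lemma paging_costE {R : realType} {l : nat} (w : 'I_l -> R) n C :
  paging_cost w n C = path_load w (prev_cache C) 0 n.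
Proof. by rewrite /path_load big_mkord. Qed.

(* The number of cache slots per class that a WIMP algorithm devotes to the
   history [s] depends on [s] only, because the relative order of the next
   requests within a class is the same for all continuations of [s]. *)
Lemma wimp_config {R : realType} {l k N : nat} (w : 'I_l -> R) (W : R) A :
  (forall i, 0 <= w i <= W) -> (forall i, (k * 2)%:R * W <= N%:R * w i) ->
  wimp_det_alg k A ->
  exists Z : seq ('I_l * nat) -> 'I_l -> nat,
    [/\ forall i, Z [::] i = 0%N, forall s, (\sum_i Z s i <= k)%N,
      forall s x, all (fun x => x.2 <= k)%N (rcons s x) ->
        (x.2 <= Z (rcons s x) x.1)%N &
      forall s, all (fun x => x.2 <= k)%N s ->
        \sum_(t < size s) upmove w (Z (take t s)) (Z (take t.+1 s)) <=
        paging_cost w (size (page_seq N k s)) (A (page_seq N k s))].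
Proof.
move=> wW NW [Afeas Ainfo]; have w0 i : 0 <= w i by have /andP[] := wW i.
pose D s := prev_cache (A (page_seq N k s)).
(* Each [Z s] is read off the run on its own padded sequence. This agreement of the runs lets all of
   them be charged to a single trajectory. As [D] is shifted by [prev_cache], it includes the cache
   at the end of the encoding. *)
have Dcat s t i : all (fun x => x.2 <= k)%N (s ++ t) ->
    (i <= size (encode N s))%N -> D s i = D (s ++ t) i.
  case: i => // i st iN; rewrite /D /=; apply: Ainfo.
    by rewrite /page_seq size_cat; lia.
  exact: wimp_info_page_seq.
have /choice[Z HZ] : forall s, exists z : 'I_l -> nat,
    [/\ s = [::] -> forall i, z i = 0%N, (\sum_i z i <= k)%N &
    forall s' x, all (fun x => x.2 <= k)%N s -> s = rcons s' x ->
      (x.2 <= z x.1)%N /\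
      upmove w (class_count (D s (size (encode N s')))) z +
      upmove w z (class_count (D s (size (encode N s)))) <=
      path_load w (D s) (size (encode N s')) (size (encode N s))].
  move=> s; case: (boolP (all (fun x => x.2 <= k)%N s)) => [|_]; last first.
    by exists (fun=> 0%N); split=> //; rewrite big1.
  case/lastP: s => [|s x] sk.
    exists (fun=> 0%N); split=> // [|s x _ /(congr1 size)]; rewrite ?big1//.
    by rewrite size_rcons.
  have [||||z [zk xz zc]] := @block_config R l w W (D (rcons s x)) k N
    (size (encode N s)) (size (encode N (rcons s x))) x.1 x.2 wW (NW x.1).
  - by move: sk; rewrite all_rcons => /andP[].
  - by rewrite encode_rcons size_cat size_block.
  - move=> j a jN am.
    apply: (Afeas (page_seq N k (rcons s x)) _ _).2; last exact: onth_page_seq.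
    by rewrite -onthTE onth_page_seq.
  - move=> t /andP[_ tN]; apply: prev_cache_le (Afeas _) _.
    by rewrite /page_seq size_cat; lia.
  exists z; split=> // [/(congr1 size)|s' x' _ /rcons_inj[<- <-]//].
  by rewrite size_rcons.
exists Z; split.
- by have [+ _ _] := HZ [::]; apply.
- by move=> s; have [] := HZ s.
- by move=> s x sx; have [_ _ /(_ s x sx erefl)[]] := HZ (rcons s x).
move=> s sk; rewrite paging_costE -/(D s).
rewrite (@path_load_cat _ _ _ _ 0 (size (encode N s)))//; last first.
  by rewrite /page_seq size_cat leq_addr.
apply: (@le_trans _ _ (path_load w (D s) 0 (size (encode N s)))); last first.
  by rewrite lerDl path_load_ge0.
(* The induction also carries the cost of returning from [Z s] to the actual cache; [block_config]
   starts the next block from there. *)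
suff : \sum_(t < size s) upmove w (Z (take t s)) (Z (take t.+1 s)) +
    upmove w (Z s) (class_count (D s (size (encode N s)))) <=
    path_load w (D s) 0 (size (encode N s)).
  by apply: le_trans; rewrite lerDl upmove_ge0.
elim/last_ind: s sk => [|s x IH] sxk.
  rewrite big_ord0 add0r /path_load big_geq// /upmove big1// => i _.
  by rewrite /D /= /class_count (_ : class_part _ _ = fset0) ?cardfs0 ?sub0n ?mulr0//;
    apply/fsetP => p; rewrite mem_class_part.
have sk : all (fun x => x.2 <= k)%N s by move: sxk; rewrite all_rcons => /andP[].
have {IH} := IH sk; have Ds i : (i <= size (encode N s))%N -> D s i = D (rcons s x) i.
  by move=> iN; rewrite -cats1; apply: Dcat => //; rewrite cats1.
rewrite Ds//.
have -> : path_load w (D s) 0 (size (encode N s)) =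
    path_load w (D (rcons s x)) 0 (size (encode N s)).
  by apply: eq_big_nat => i /andP[_ iN]; rewrite !Ds// ltnW.
have [_ _ /(_ s x sxk erefl)[_]] := HZ (rcons s x).
rewrite size_rcons big_ord_recr /=.
have -> : \sum_(t < size s) upmove w (Z (take t (rcons s x)))
    (Z (take t.+1 (rcons s x))) =
    \sum_(t < size s) upmove w (Z (take t s)) (Z (take t.+1 s)).
  by apply: eq_bigr => t _; rewrite -cats1 !takel_cat// ltnW.
have -> : take (size s) (rcons s x) = s by rewrite -cats1 take_size_cat.
have -> : take (size s).+1 (rcons s x) = rcons s x.
  by rewrite take_oversize ?size_rcons.
rewrite (@path_load_cat _ _ _ (D (rcons s x)) 0 (size (encode N s))
  (size (encode N (rcons s x))))//; last first.
  by rewrite encode_rcons size_cat leq_addr.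
have := upmove_triangle w (class_count (D (rcons s x) (size (encode N s))))
  (Z s) (Z (rcons s x)) w0.
lra.
Qed.

(** * Lazy integer tracking *)

(* An integer point follows [u] with a lag in [0, 3] and moves only when the
   lag leaves this window; [2 * `|lag - 3/2|] is the potential. *)
Lemma lazy_tracking_int {R : realType} (u : nat -> R) :
  exists z : nat -> int,
    (forall t, 0 <= u t - (z t)%:~R <= 3) /\
    (forall n, \sum_(t < n) `|(z t.+1)%:~R - (z t)%:~R| <=
      2 * (\sum_(t < n) `|u t.+1 - u t|) + 1).
Proof.
(* A jump resets the lag to [1, 2), around the centre 3/2, so the potential is at most 1 afterwards;
   the same holds initially, which gives the final [+ 1]. *)
pose fix z t : int := if t is t'.+1 then
  if 0 <= u t - (z t')%:~R <= 3 then z t' else Num.floor (u t - 1)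
  else Num.floor (u 0 - 1).
have fl x : (Num.floor (x - 1))%:~R <= x - 1 /\
    x - 1 < (Num.floor (x - 1))%:~R + 1 :> R.
  by have /andP[] := floor_itv (x - 1); rewrite intrD.
have ztS t : z t.+1 =
    if 0 <= u t.+1 - (z t)%:~R <= 3 then z t else Num.floor (u t.+1 - 1).
  by [].
exists z; split=> [[|t]|n].
- by have [] := fl (u 0); rewrite [z 0]/=; lra.
- by rewrite ztS; case: ifP => // _; have [] := fl (u t.+1); lra.
suff : \sum_(t < n) `|(z t.+1)%:~R - (z t)%:~R| +
    2 * `|u n - (z n)%:~R - 3 / 2| <=
    2 * (\sum_(t < n) `|u t.+1 - u t|) + 1.
  by have := normr_ge0 (u n - (z n)%:~R - 3 / 2); lra.
elim: n => [|n IH].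
  rewrite !big_ord0 [z 0]/=; have [] := fl (u 0) => h1 h2.
  have : `|u 0 - (Num.floor (u 0 - 1))%:~R - 3 / 2| <= 1 / 2.
    by rewrite ler_norml; lra.
  lra.
rewrite !big_ord_recr /= -/(z n) -/(z n.+1).
move: IH; set S := \sum_(i < n) _; set S' := \sum_(i < n) _ => IH.
have := fl (u n.+1); set f := (Num.floor _)%:~R => -[f1 f2].
rewrite ztS; case: ifP => [_|/negbT].
  rewrite subrr normr0 addr0; move: IH.
  have := ler_normD (u n - (z n)%:~R - 3 / 2) (u n.+1 - u n).
  have -> : u n - (z n)%:~R - 3 / 2 + (u n.+1 - u n) =
    u n.+1 - (z n)%:~R - 3 / 2 by ring.
  lra.
rewrite negb_and -!ltNge -/f => bad.
have h1 : `|u n.+1 - f - 3 / 2| <= 1 / 2 by rewrite ler_norml; lra.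
have h2 := ler_normD (u n - (z n)%:~R - 3 / 2) (u n.+1 - u n).
have e2 : u n - (z n)%:~R - 3 / 2 + (u n.+1 - u n) =
    u n.+1 - (z n)%:~R - 3 / 2 by ring.
rewrite e2 in h2.
(* The drop of the potential pays for the jump. The window width 3 is what makes this hold for a lag
   just above it. *)
have h3 : `|f - (z n)%:~R| <= 2 * `|u n.+1 - (z n)%:~R - 3 / 2| - 1.
  case/orP: bad => bad.
    by rewrite ltr0_norm ?ltr0_norm; lra.
  by rewrite ger0_norm ?ger0_norm; lra.
lra.
Qed.

(** Negative integers are clipped to 0, which does not enlarge any increase. The first clause is
    conditional because an offline solution is known to be nonnegative only up to the end of the
    requests. *)
Lemma lazy_tracking {R : realType} (u : nat -> R) :
  exists v : nat -> nat,
    [/\ forall t, 0 <= u t -> (v t)%:R <= u t,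
        forall t, u t <= (v t)%:R + 3 &
        forall n, \sum_(t < n) (v t.+1 - v t)%N%:R <=
          2 * (\sum_(t < n) `|u t.+1 - u t|) + 1].
Proof.
have [z [zu zcost]] := lazy_tracking_int u.
pose pos (a : int) := if a is Posz m then m else 0%N.
exists (pos \o z); split => [t ut|t|n] /=.
- have := zu t; case: (z t) => m /=; rewrite ?mulr0n//.
  by rewrite -pmulrn; lra.
- have := zu t; case: (z t) => m /=; first by rewrite -pmulrn; lra.
  by rewrite NegzE mulrNz -pmulrn; have := ler0n R m.+1; lra.
apply: le_trans (zcost n); apply: ler_sum => t _.
case: (z t.+1) => b /=; last first.
  rewrite sub0n; exact: normr_ge0.
case: (z t) => a /=.
  rewrite -!pmulrn; have [ab|ab] := leqP a b; last first.
    have -> : (b - a = 0)%N by lia.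
    exact: normr_ge0.
  by rewrite natrB// ler_norm.
rewrite subn0 NegzE mulrNz opprK -!pmulrn.
by apply: le_trans (ler_norm _); rewrite lerDl.
Qed.

(** Initial segments of the classes: they contain the scanned rows, and they are nested, so passing
    from one to another loads only the increase of each count. *)
Definition config_cache {l : nat} (n : 'I_l -> nat) : {fset page l} :=
  [fset p in flatten [seq row_pages i (n i) | i <- enum 'I_l]]%fset.

Lemma mem_config_cache {l : nat} (n : 'I_l -> nat) i a :
  ((i, a) \in config_cache n) = (a < n i)%N.
Proof.
rewrite !inE /=; apply/flattenP/idP => [[_ /mapP[j _ ->]]|an].
  by rewrite mem_row => /andP[/eqP-> ].
exists (row_pages i (n i)); last by rewrite mem_row eqxx.
by apply/mapP; exists i; rewrite ?mem_enum.
Qed.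

Lemma class_count_config_cacheD {l : nat} (a b : 'I_l -> nat) i :
  (class_count (config_cache b `\` config_cache a)%fset i <= b i - a i)%N.
Proof.
rewrite -[leqRHS](size_iota (a i)) -(size_map (pair i)).
apply: (@leq_trans #|` [fset p in [seq (i, j) | j <- iota (a i) (b i - a i)]]%fset|).
  apply: fsubset_leq_card; apply/fsubsetP => -[q j].
  rewrite mem_class_part in_fsetD !mem_config_cache /= => /andP[/andP[aj jb] /eqP qi].
  rewrite {q}qi in aj jb *; rewrite in_fset /=.
  apply/mapP; exists j => //; rewrite mem_iota; lia.
by rewrite card_fseq size_undup.
Qed.

Lemma load_config_cache {R : realType} {l : nat} (w : 'I_l -> R)
    (a b : 'I_l -> nat) : (forall i, 0 <= w i) ->
  load w (config_cache a) (config_cache b) <= upmove w a b.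
Proof.
move=> w0; rewrite loadE; apply: ler_sum => i _.
by rewrite ler_wpM2l// ler_nat class_count_config_cacheD.
Qed.

Lemma card_config_cache {l : nat} (n : 'I_l -> nat) :
  (#|` config_cache n| <= \sum_i n i)%N.
Proof.
rewrite -sum_class_count; apply: leq_sum => i _.
have := class_count_config_cacheD (fun=> 0%N) n i; rewrite subn0.
apply: leq_trans; apply: fsubset_leq_card; apply/fsubsetP => -[q j].
by rewrite !mem_class_part in_fsetD !mem_config_cache.
Qed.

Lemma load_self {R : realType} {l : nat} (w : 'I_l -> R) (A : {fset page l}) :
  load w A A = 0.
Proof. by rewrite /load fsetDv big_seq_fset0. Qed.

Lemma load_fset1_le {R : realType} {l : nat} (w : 'I_l -> R) (A : {fset page l})
    (p : page l) : (forall i, 0 <= w i) -> load w A [fset p]%fset <= w p.1.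
Proof.
move=> w0; rewrite /load; case: (boolP (p \in A)) => pA.
  by rewrite (_ : _ `\` _ = fset0)%fset ?big_seq_fset0//;
    apply/eqP; rewrite fsetD_eq0 fsub1set.
rewrite (_ : _ `\` _ = [fset p])%fset ?big_seq_fset1//.
by apply/fsetDidPl; rewrite fdisjoint1X.
Qed.

(** If [n] is 0, nothing happens and the debt of loading [X] remains; otherwise the first step pays
    it and no load follows. *)
Lemma path_load_const {R : realType} {l : nat} (w : 'I_l -> R) D X (lo n : nat) :
  (forall i, 0 <= w i) -> (forall i, (lo <= i)%N -> D i.+1 = X) ->
  path_load w D lo (lo + n) + load w (D (lo + n)%N) X <= load w (D lo) X.
Proof.
move=> w0 DX; elim: n => [|n IH].
  by rewrite addn0 /path_load big_geq// add0r.
rewrite (@path_load_cat _ _ _ _ lo (lo + n)) ?leq_add2l ?leq_addr//.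
rewrite addnS [X in _ + X + _]/path_load big_nat1.
by rewrite DX ?leq_addr// load_self addr0.
Qed.

Lemma paging_feasible_cat {l k : nat} (u v : seq (page l)) C C' :
  paging_feasible k u C -> paging_feasible k v C' ->
  paging_feasible k (u ++ v)
    (fun i => if (i < size u)%N then C i else C' (i - size u)%N).
Proof.
move=> Cu C'v i; rewrite size_cat => iuv; case: ifP => iu.
  have [Ck Cp] := Cu i iu; split=> // p; rewrite onth_cat iu; exact: Cp.
have iv : (i - size u < size v)%N by lia.
have [Ck Cp] := C'v _ iv; split=> // p; rewrite onth_cat iu; exact: Cp.
Qed.

Lemma prev_cache_if {l : nat} (n : nat) (C C' : nat -> {fset page l}) i :
  (i <= n)%N ->
  prev_cache (fun i => if (i < n)%N then C i else C' i) i = prev_cache C i.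
Proof. by case: i => // i ii /=; rewrite ii. Qed.

(** The cache changes only at requests, so an empty block leaves it behind its target. The [load]
    term records this debt and makes the induction go through. *)
Lemma config_paging {R : realType} {l : nat} (w : 'I_l -> R) (N k : nat)
    (s : seq ('I_l * nat)) (n : nat -> 'I_l -> nat) :
  (forall i, 0 <= w i) ->
  (forall t, (t <= size s)%N -> (\sum_i n t i <= k)%N) ->
  (forall t r m, onth s t = Some (r, m) -> (m <= n t.+1 r)%N) ->
  exists2 C, paging_feasible k (encode N s) C &
    paging_cost w (size (encode N s)) C +
    load w (prev_cache C (size (encode N s))) (config_cache (n (size s))) <=
    upmove w (fun=> 0%N) (n 0%N) + \sum_(t < size s) upmove w (n t) (n t.+1).
Proof.
move=> w0; elim/last_ind: s => [|s x IH] nk ns.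
  exists (fun=> fset0) => //; rewrite paging_costE /path_load big_geq// add0r.
  rewrite big_ord0 addr0 /=; apply: le_trans (load_config_cache w (fun=> 0%N) _ w0).
  rewrite !loadE; apply: ler_sum => i _; rewrite ler_wpM2l// ler_nat.
  apply: fsubset_leq_card; apply/fsubsetP => -[q a].
  by rewrite !mem_class_part !in_fsetD !mem_config_cache inE.
have [||C Cs Cc] := IH.
- by move=> t ts; apply: nk; rewrite size_rcons; lia.
- move=> t r m stm; apply: ns; rewrite -cats1 onth_cat ifT//.
  by rewrite -onthTE stm.
set T := size (encode N s).
set X := config_cache (n (size s).+1).
exists (fun i => if (i < T)%N then C i else X).
  rewrite encode_rcons.
  apply: (paging_feasible_cat _ _ _ (fun=> X)) => // i iN; split.
    apply: leq_trans (card_config_cache _) _; apply: nk.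
    by rewrite size_rcons.
  move=> [q a] e; have : (q, a) \in block N x by apply/onthP; exists i.
  case/flattenP => r0 /nseqP[-> _]; rewrite mem_row => /andP[/eqP-> ax].
  rewrite /X mem_config_cache; apply: leq_trans ax _; apply: ns.
  by rewrite onthE map_rcons nth_rcons size_map ltnn eqxx; case: (x).
rewrite paging_costE encode_rcons size_cat -/T size_rcons big_ord_recr /=.
set D := prev_cache _.
have DC i : (i <= T)%N -> D i = prev_cache C i by exact: prev_cache_if.
have DX i : (T <= i)%N -> D i.+1 = X by move=> Ti; rewrite /D /= ltnNge Ti.
rewrite (@path_load_cat _ _ _ _ 0 T)// ?leq_addr//.
have -> : path_load w D 0 T = paging_cost w T C.
  rewrite paging_costE; apply: eq_big_nat => i /andP[_ iT].
  by rewrite !DC// ltnW.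
have := path_load_const w D X T (size (block N x)) w0 DX.
rewrite (DC T (leqnn T)) => h1; move: Cc; rewrite -/T => h2.
have h3 := load_triangle w (config_cache (n (size s))) (prev_cache C T) X w0.
have h4 := load_config_cache w (n (size s)) (n (size s).+1) w0.
move: h1 h2 h3 h4; rewrite -/X; lra.
Qed.

(** The final padding is served with one page in the cache at a time; its cost does not depend on
    [s] and ends up in the additive constant. *)
Lemma config_paging_page_seq {R : realType} {l : nat} (w : 'I_l -> R) (W : R)
    (N k : nat) (s : seq ('I_l * nat)) (n : nat -> 'I_l -> nat) :
  (forall i, 0 <= w i <= W) -> (0 < k)%N ->
  (forall t, (t <= size s)%N -> (\sum_i n t i <= k)%N) ->
  (forall t r m, onth s t = Some (r, m) -> (m <= n t.+1 r)%N) ->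
  exists2 C, paging_feasible k (page_seq N k s) C &
    paging_cost w (size (page_seq N k s)) C <=
    upmove w (fun=> 0%N) (n 0%N) + \sum_(t < size s) upmove w (n t) (n t.+1) +
    (size (all_pages l k))%:R * W.
Proof.
move=> wW k0 nk ns; have w0 i : 0 <= w i by have /andP[] := wW i.
have [C Cs Cc] := config_paging w N k s n w0 nk ns.
set T := size (encode N s).
pose C' i := if onth (all_pages l k) i is Some p then [fset p]%fset else fset0.
exists (fun i => if (i < T)%N then C i else C' (i - T)%N).
  apply: paging_feasible_cat => // i; rewrite /C' -onthTE.
  case: onth => // p _; split=> [|q [<-]]; last by rewrite inE.
  by have -> : #|` [fset p]%fset| = 1%N by exact: cardfs1.
rewrite paging_costE size_cat -/T (@path_load_cat _ _ _ _ 0 T)// ?leq_addr//.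
apply: lerD.
  apply: le_trans Cc; rewrite -[leLHS]addr0 lerD ?load_ge0//.
  rewrite paging_costE le_eqVlt; apply/orP; left; apply/eqP.
  apply: eq_big_nat => i /andP[_ iT].
  by rewrite !(prev_cache_if T C (fun i => C' (i - T)%N))// ltnW.
set S := size (all_pages l k).
apply: (@le_trans _ _ (\sum_(T <= i < T + S) W)); last first.
  by rewrite sumr_const_nat addKn mulr_natl.
apply: ler_sum_nat => i /andP[Ti iT] /=; rewrite ltnNge Ti /= /C'.
have : (i - T < S)%N by lia.
rewrite -onthTE; case: onth => // p _.
by apply: le_trans (load_fset1_le w _ p w0) _; have /andP[] := wW p.1.
Qed.

(** * From paging to allocation *)

(* The 3 is the lag allowed by [lazy_tracking]; it disappears as [k] grows. *)
Definition slots {R : realType} (k : nat) (c : R) : nat :=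
  (Num.truncn (k%:R * c) - 3)%N.

Definition slot_reqs {R : realType} {l : nat} (k : nat) (rs : seq ('I_l * R)) :
  seq ('I_l * nat) := [seq (x.1, slots k x.2) | x <- rs].

Lemma slots_le {R : realType} (k n : nat) (c : R) :
  0 <= c -> k%:R * c <= n%:R + 3 -> (slots k c <= n)%N.
Proof.
move=> c0 h; rewrite /slots leq_subLR -(ler_nat R).
apply: (@le_trans _ _ (k%:R * c)); first by rewrite truncn_le// mulr_ge0.
by rewrite natrD addrC.
Qed.

(** Lag 3 plus rounding by at most 1; divided by [k], this becomes the threshold error [4 / k]. *)
Lemma le_slots {R : realType} (k : nat) (c : R) : k%:R * c <= (slots k c)%:R + 4.
Proof.
have := truncnS_gt (k%:R * c); rewrite /slots.
set n := Num.truncn _ => h; apply: (le_trans (ltW h)).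
by rewrite -natrD ler_nat; lia.
Qed.

Lemma all_slot_reqs {R : realType} {l : nat} (k : nat) (rs : seq ('I_l * R)) :
  valid_reqs rs -> all (fun x => x.2 <= k)%N (slot_reqs k rs).
Proof.
rewrite all_map; apply: sub_all => -[r c] /= /andP[c0 c1].
apply: slots_le => //; have := ler0n R k; nra.
Qed.

(** Starting from zero, the decreases total the increases minus the final level. *)
Lemma upmove_sumE {R : realType} {l : nat} (w : 'I_l -> R)
    (Z : nat -> 'I_l -> nat) (n : nat) :
  (forall i, Z 0%N i = 0%N) ->
  \sum_(t < n) \sum_i w i * `|(Z t.+1 i)%:R - (Z t i)%:R| +
    \sum_i w i * (Z n i)%:R = 2 * \sum_(t < n) upmove w (Z t) (Z t.+1).
Proof.
move=> Z0; elim: n => [|n IH].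
  by rewrite !big_ord0 add0r mulr0 big1// => i _; rewrite Z0 mulr0.
rewrite !big_ord_recr mulrDr -IH /= -!addrA; congr (_ + _).
rewrite /upmove mulr_sumr -!big_split; apply: eq_bigr => i _ /=.
have [ab|ba] := leqP (Z n i) (Z n.+1 i).
  by rewrite natrB// ger0_norm ?subr_ge0 ?ler_nat//; ring.
rewrite ler0_norm ?subr_le0 ?ler_nat 1?ltnW//.
have -> : (Z n.+1 i - Z n i = 0)%N by lia.
ring.
Qed.

(** Requesting [n] distinct pages with a one-page cache costs [n * w r] offline; a negative ratio
    would eventually bound a nonnegative expected cost by a negative number. *)
Lemma competitive_ratio_ge0 {R : realType} {l k : nat} (w : 'I_l -> R) (rho : R) :
  (0 < l)%N -> (forall i, 0 < w i) -> (0 < k)%N -> wimp_competitive k w rho ->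
  0 <= rho.
Proof.
move=> l0 w0 k0 [d [Om [P [A [b [_ [_ Acomp]]]]]]].
pose r : 'I_l := Ordinal l0.
have cost n : 0 <= rho * (n%:R * w r) + b.
  pose s : seq (page l) := row_pages r n.
  pose C i : {fset page l} := [fset (r, i)]%fset.
  have Cs : paging_feasible k s C.
    move=> i _; split; first by have -> : #|` C i| = 1%N by exact: cardfs1.
    move=> p; rewrite /s /row_pages onth_map onthE.
    have [iN|iN] := ltnP i n; last by rewrite nth_default// size_map size_iota.
    by rewrite (nth_map 0%N) ?size_iota// nth_iota//= => -[<-]; rewrite inE.
  have := Acomp s C Cs; have -> : paging_cost w (size s) C = n%:R * w r.
    rewrite /paging_cost size_row (eq_bigr (fun=> w r)).
      by rewrite sumr_const card_ord mulr_natl.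
    move=> i _; rewrite (_ : _ `\` _ = C i)%fset ?big_seq_fset1//.
    case: i => -[|i] iN; rewrite /C /prev_cache ?fsetD0//=.
    apply/fsetDidPl; rewrite fdisjoint1X inE xpair_eqE eqxx /=; lia.
  rewrite -lee_fin; apply: le_trans; apply: integral_ge0 => om _.
  rewrite lee_fin; apply: sumr_ge0 => i _; apply: sumr_ge0 => p _.
  exact: ltW.
rewrite leNgt; apply/negP => rho0.
have := cost (Num.truncn (b / (- rho * w r))).+1.
have := truncnS_gt (b / (- rho * w r)).
rewrite ltr_pdivrMr; last by rewrite mulr_gt0 ?oppr_gt0.
move: (_.+1%:R) => n; lra.
Qed.

(** The factor [k.+1] covers at most [k] pages per class for the initial configuration and the
    additive 1 of [lazy_tracking]. *)
Lemma paging_of_alloc {R : realType} {l : nat} (w : 'I_l -> R) (W : R) (k N : nat)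
    (x0 : 'I_l -> R) (rs : seq ('I_l * R)) (y : nat -> 'I_l -> R) :
  (forall i, 0 <= w i <= W) -> (0 < k)%N -> valid_reqs rs ->
  alloc_offline_feasible x0 rs y ->
  exists2 C, paging_feasible k (page_seq N k (slot_reqs k rs)) C &
    paging_cost w (size (page_seq N k (slot_reqs k rs))) C <=
    2 * k%:R * alloc_cost w y (size rs) +
    ((\sum_i w i) * k.+1%:R + (size (all_pages l k))%:R * W).
Proof.
move=> wW k0 rsv [_ [ys yc]]; have w0 i : 0 <= w i by have /andP[] := wW i.
have /choice[v Hv] := fun i => lazy_tracking (fun t => k%:R * y t i).
pose n t i := v i t.
have nle t i : (t <= size rs)%N -> (n t i)%:R <= k%:R * y t i.
  move=> ts; have [+ _ _] := Hv i; apply; rewrite mulr_ge0//.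
  by have [/(_ i)/andP[]] := ys t ts.
have nsum t : (t <= size rs)%N -> (\sum_i n t i <= k)%N.
  move=> ts; rewrite -(ler_nat R) natr_sum.
  apply: (@le_trans _ _ (\sum_i k%:R * y t i)).
    by apply: ler_sum => i _; exact: nle.
  by rewrite -mulr_sumr (ys t ts).2 mulr1.
have [||C Cf Cc] := config_paging_page_seq w W N k (slot_reqs k rs) n wW k0.
- by move=> t; rewrite size_map; exact: nsum.
- move=> t r m; rewrite onth_map; case e: (onth rs t) => [[r' c]|]//= -[<- <-].
  have /(allP rsv)/andP[/= c0 _] : (r', c) \in rs by apply/onthP; exists t.
  apply: slots_le => //; have [_ + _] := Hv r' => /(_ t.+1).
  by apply: le_trans; rewrite ler_wpM2l//; exact: yc e.
exists C => //; apply: le_trans Cc _; rewrite size_map addrA lerD2r.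
have -> : alloc_cost w y (size rs) =
    \sum_i w i * \sum_(t < size rs) `|y t.+1 i - y t i|.
  rewrite /alloc_cost exchange_big /=.
  by apply: eq_bigr => i _; rewrite mulr_sumr.
have -> : \sum_(t < size rs) upmove w (n t) (n t.+1) =
    \sum_i w i * \sum_(t < size rs) (n t.+1 i - n t i)%N%:R.
  by rewrite exchange_big; apply: eq_bigr => i _; rewrite mulr_sumr.
rewrite /upmove mulr_sumr mulr_suml -!big_split; apply: ler_sum => i _ /=.
have -> : 2 * k%:R * (w i * \sum_(t < size rs) `|y t.+1 i - y t i|) +
    w i * k.+1%:R =
    w i * (k.+1%:R + 2 * (k%:R * \sum_(t < size rs) `|y t.+1 i - y t i|)) by ring.
rewrite -mulrDr; apply: ler_wpM2l => //; rewrite subn0.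
have n0k : (n 0%N i)%:R <= k%:R :> R.
  by rewrite ler_nat; apply: leq_trans (nsum 0%N isT); rewrite (bigD1 i)//= leq_addr.
have [_ _ /(_ (size rs))] := Hv i.
have -> : \sum_(t < size rs) `|k%:R * y t.+1 i - k%:R * y t i| =
    k%:R * \sum_(t < size rs) `|y t.+1 i - y t i|.
  by rewrite mulr_sumr; apply: eq_bigr => t _; rewrite -mulrBr normrM normr_nat.
rewrite -natr1 /n; move: n0k; rewrite /n; lra.
Qed.

(** [start] restricts the offline starting states: first the algorithm's own initial state only,
    after the restart any state. *)
Definition near_alloc {R : realType} {l : nat} (w : 'I_l -> R) (rho eps : R)
    (start : ('I_l -> R) -> Prop) (b : R) (X : seq ('I_l * R) -> 'I_l -> R) : Prop :=
  [/\ forall rs, valid_reqs rs -> in_simplex (X rs),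
      forall rs r c, valid_reqs (rcons rs (r, c)) ->
        c <= X (rcons rs (r, c)) r + eps &
      forall rs y, valid_reqs rs -> start (y 0%N) ->
        alloc_offline_feasible (y 0%N) rs y ->
        alloc_cost w (fun t => X (take t rs)) (size rs) <=
        rho * alloc_cost w y (size rs) + b].

(** Caches need not be full, so averaged shares may sum to less than 1; the deficit is put on
    [i0]. *)
Definition completion {R : realType} {l : nat} (i0 : 'I_l) (x : 'I_l -> R)
  : 'I_l -> R := fun i => x i + (if i == i0 then 1 - \sum_j x j else 0).

Lemma completion_simplex {R : realType} {l : nat} (i0 : 'I_l) (x : 'I_l -> R) :
  (forall i, 0 <= x i) -> \sum_j x j <= 1 -> in_simplex (completion i0 x).
Proof.
move=> x0 x1.
have c0 i : 0 <= completion i0 x i.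
  by rewrite /completion addr_ge0//; case: ifP => // _; rewrite subr_ge0.
have c1 : \sum_i completion i0 x i = 1.
  by rewrite /completion big_split /= -big_mkcond big_pred1_eq addrC subrK.
split=> // i; rewrite c0/= -c1 (bigD1 i)//= lerDl sumr_ge0//.
Qed.

(* The completed mass sits on a lightest coordinate, so moving it costs at most
   as much as moving the coordinates it compensates for. *)
Lemma move_cost_completion {R : realType} {l : nat} (w : 'I_l -> R) (i0 : 'I_l)
    (x y : 'I_l -> R) :
  (forall i, 0 <= w i) -> (forall i, w i0 <= w i) ->
  move_cost w (completion i0 x) (completion i0 y) <= 2 * move_cost w x y.
Proof.
move=> w0 wmin; rewrite /move_cost /completion.
apply: (@le_trans _ _ (\sum_i (w i * `|y i - x i| +
    if i == i0 then w i * `|\sum_j (x j - y j)| else 0))).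
  apply: ler_sum => i _; case: ifP => _; last by rewrite !addr0.
  rewrite -mulrDr ler_wpM2l//; apply: le_trans (ler_normD _ _).
  by rewrite sumrB le_eqVlt; apply/orP; left; apply/eqP; congr (`|_|); ring.
rewrite big_split /= -big_mkcond big_pred1_eq mulr_natl mulr2n lerD2l.
apply: le_trans (ler_wpM2l (w0 i0) (ler_norm_sum _ _ _)) _.
rewrite mulr_sumr; apply: ler_sum => i _.
by rewrite distrC ler_wpM2r.
Qed.

Lemma min_index {R : realType} {l : nat} (w : 'I_l -> R) :
  (0 < l)%N -> exists i0, forall i, w i0 <= w i.
Proof.
move=> l0; have [i _ Hi] := arg_minP w (erefl true : predT (Ordinal l0)).
by exists i => j; exact: Hi.
Qed.

Lemma alloc_of_wimp {R : realType} {l k : nat} (w : 'I_l -> R) (phi : R) :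
  (0 < l)%N -> (forall i, 0 < w i) -> (0 < k)%N -> wimp_competitive k w phi ->
  exists b X, near_alloc w (8 * phi) (4 / k%:R) (fun x0 => x0 = X [::]) b X.
Proof.
move=> l0 wpos k0 wimp; have phi0 := competitive_ratio_ge0 w phi l0 wpos k0 wimp.
have kpos : 0 < k%:R :> R by rewrite ltr0n.
have [i0 wmin] := min_index w l0.
have w0 i : 0 <= w i by exact: ltW.
pose W := \sum_i w i.
have wW i : 0 <= w i <= W by rewrite w0/= /W (bigD1 i)//= lerDl sumr_ge0.
pose N := (Num.truncn ((k * 2)%:R * W / w i0)).+1.
have NW i : (k * 2)%:R * W <= N%:R * w i.
  apply: (@le_trans _ _ (N%:R * w i0)); last by rewrite ler_wpM2l.
  by rewrite -ler_pdivrMr// ltW// truncnS_gt.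
have [d [Om [P [A [b [Adet [Ameas Acomp]]]]]]] := wimp.
have /choice[Z HZ] := fun om => wimp_config w W (A om) wW NW (Adet om).
have [M mM MP] := expectation_mean _ _ P; have [MD MZ Mle Mc] := mM.
pose ZR s i om : R := (Z om s i)%:R.
have Zk om s i : (Z om s i <= k)%N.
  have [_ /(_ s) + _ _] := HZ om; apply: leq_trans.
  by rewrite (bigD1 i)//= leq_addr.
have bZ s i : bounded_fct (ZR s i).
  by exists k%:R => om; rewrite normr_nat ler_nat.
pose x s i := M (ZR s i) / k%:R.
have x0 s i : 0 <= x s i.
  rewrite divr_ge0// -(Mc 0); apply: (Mle _ _ (bounded_cst 0)) => // om.
have x1 s : \sum_i x s i <= 1.
  rewrite -mulr_suml ler_pdivrMr// mul1r -mean_sum//.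
  rewrite -(Mc k%:R); apply: (Mle _ _ (bounded_sum _ _ (bZ s)) (bounded_cst _)) => om.
  by rewrite -natr_sum ler_nat; have [_ /(_ s)] := HZ om.
pose X (rs : seq (_ * R)) := completion i0 (x (slot_reqs k rs)).
exists (4 / k%:R * (phi * ((\sum_i w i) * k.+1%:R +
  (size (all_pages l k))%:R * W) + b)), X; split.
- by move=> rs _; exact: completion_simplex.
- move=> rs r c rsv.
  have h1 : x (slot_reqs k (rcons rs (r, c))) r <= X (rcons rs (r, c)) r.
    by rewrite /X /completion lerDl; case: ifP => // _; rewrite subr_ge0.
  apply: (@le_trans _ _ (x (slot_reqs k (rcons rs (r, c))) r + 4 / k%:R)); last first.
    by rewrite lerD2r.
  rewrite -mulrDl ler_pdivlMr// mulrC; apply: le_trans (le_slots k c) _.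
  rewrite lerD2r -(Mc (slots k c)%:R); apply: (Mle _ _ (bounded_cst _)) => // om.
  rewrite /ZR ler_nat; have [_ _ + _] := HZ om.
  move=> /(_ (slot_reqs k rs) (r, slots k c)).
  by rewrite /slot_reqs map_rcons; apply; have := all_slot_reqs k _ rsv;
    rewrite /slot_reqs map_rcons.
- move=> rs y rsv _ fy.
  have [C Cf Cc] := paging_of_alloc w W k N _ rs y wW k0 rsv fy.
  set s := slot_reqs k rs in Cf Cc.
  have sk : all (fun x => x.2 <= k)%N s by exact: all_slot_reqs.
  (* Half the total variation is at most the total increase, hence at most the paging cost. Unlike
     that cost, [F] is visibly bounded in [om], as [M] requires. *)
  pose F om := 2^-1 * \sum_(t < size rs) \sum_i
    w i * `|ZR (take t.+1 s) i om - ZR (take t s) i om|.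
  have bF' (t : 'I_(size rs)) i : bounded_fct
      (fun om => w i * `|ZR (take t.+1 s) i om - ZR (take t s) i om|).
    by apply: bounded_scale; apply: bounded_norm; exact: bounded_sub.
  have bF'' (t : 'I_(size rs)) : bounded_fct (fun om => \sum_i
      w i * `|ZR (take t.+1 s) i om - ZR (take t s) i om|).
    exact: bounded_sum.
  have MF : M F <= phi * paging_cost w (size (page_seq N k s)) C + b.
    apply: (MP F (fun om => paging_cost w (size (page_seq N k s))
      (A om (page_seq N k s)))) => //.
    - by apply: bounded_scale; exact: bounded_sum.
    - by move=> om; apply: sumr_ge0 => i _; exact: load_ge0.
    - move=> om; rewrite /F ler_pdivrMl//.
      have [Z0 _ _ /(_ s sk)] := HZ om; rewrite size_map => up.
      apply: (le_trans _ (ler_wpM2l (ler0n R 2) up)).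
      rewrite -(upmove_sumE w (fun t => Z om (take t s))) => [|i]; last first.
        by rewrite take0.
      by rewrite lerDl sumr_ge0// => i _; rewrite mulr_ge0.
    - exact: Acomp.
  (* In [4 / k], one factor 2 comes from the completion, the other undoes the half in [F], and [k]
     turns slots into shares. *)
  have cX : alloc_cost w (fun t => X (take t rs)) (size rs) <= 4 / k%:R * M F.
    have -> : M F = 2^-1 * \sum_(t < size rs) \sum_i w i *
        M (fun om => `|ZR (take t.+1 s) i om - ZR (take t s) i om|).
      rewrite /F MZ; last exact: bounded_sum.
      rewrite mean_sum//; congr (_ * _); apply: eq_bigr => t _.
      rewrite mean_sum//; apply: eq_bigr => i _.
      by rewrite MZ//; apply: bounded_norm; exact: bounded_sub.
    have -> : 4 / k%:R * (2^-1 * \sum_(t < size rs) \sum_i w i *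
        M (fun om => `|ZR (take t.+1 s) i om - ZR (take t s) i om|)) =
      \sum_(t < size rs) 2 * \sum_i w i *
        (M (fun om => `|ZR (take t.+1 s) i om - ZR (take t s) i om|) / k%:R).
      rewrite mulrA mulr_sumr; apply: eq_bigr => t _.
      rewrite !mulr_sumr; apply: eq_bigr => i _; field.
      by rewrite gt_eqF.
    apply: ler_sum => t _; apply: le_trans (move_cost_completion w i0 _ _ w0 wmin) _.
    rewrite ler_wpM2l//; apply: ler_sum => i _; rewrite ler_wpM2l//.
    rewrite /x -mulrBl normrM (normfV k%:R) normr_nat// ler_wpM2r ?invr_ge0//.
    by rewrite /slot_reqs !map_take; exact: mean_dist.
  apply: le_trans cX _; have q0 : 0 <= 4 / k%:R :> R by rewrite divr_ge0.
  apply: le_trans (ler_wpM2l q0 MF) _.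
  apply: (@le_trans _ _ (4 / k%:R * (phi * (2 * k%:R * alloc_cost w y (size rs) +
    ((\sum_i w i) * k.+1%:R + (size (all_pages l k))%:R * W)) + b))).
    by rewrite ler_wpM2l// lerD2r ler_wpM2l.
  rewrite le_eqVlt; apply/orP; left; apply/eqP; field.
  by rewrite gt_eqF.
Qed.

(** * Restarting and passing to the limit *)

Lemma move_cost_triangle {R : realType} {l : nat} (w : 'I_l -> R)
    (y x z : 'I_l -> R) :
  (forall i, 0 <= w i) -> move_cost w x z <= move_cost w x y + move_cost w y z.
Proof.
move=> w0; rewrite /move_cost -big_split; apply: ler_sum => i _ /=.
by rewrite -mulrDr ler_wpM2l// [leRHS]addrC ler_distD.
Qed.

Lemma move_cost_simplex {R : realType} {l : nat} (w : 'I_l -> R)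
    (x y : 'I_l -> R) :
  (forall i, 0 <= w i) -> in_simplex x -> in_simplex y ->
  move_cost w x y <= \sum_i w i.
Proof.
move=> w0 [x01 _] [y01 _]; apply: ler_sum => i _.
rewrite -[leRHS]mulr1 ler_wpM2l// ler_norml.
by have := x01 i; have := y01 i; lra.
Qed.

Lemma alloc_cost_cat {R : realType} {l : nat} (w : 'I_l -> R) y m n :
  alloc_cost w y (m + n) =
  alloc_cost w y m + \sum_(t < n) move_cost w (y (m + t)%N) (y (m + t).+1).
Proof. by rewrite /alloc_cost big_split_ord. Qed.

(* Started after a history that nearly maximizes its regret
   [cost - rho * OPT], the algorithm has an additive constant that no longer
   depends on the original one. *)
Lemma restart_alloc {R : realType} {l : nat} (w : 'I_l -> R) (rho eps b : R) X :
  0 <= rho -> (forall i, 0 <= w i) ->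
  near_alloc w rho eps (fun x0 => x0 = X [::]) b X ->
  exists X', near_alloc w rho eps (fun=> True) (rho * (\sum_i w i) + 1) X'.
Proof.
move=> rho0 w0 [Xs Xf Xc].
pose S := [set v | exists h y, [/\ valid_reqs h, y 0%N = X [::],
  alloc_offline_feasible (y 0%N) h y &
  v = alloc_cost w (fun t => X (take t h)) (size h) -
      rho * alloc_cost w y (size h)]].
have Sb v : S v -> v <= b.
  by move=> [h [y [hv y0 fy ->]]]; have := Xc h y hv y0 fy; lra.
have supS : has_sup S.
  split; last by exists b.
  exists 0, [::], (fun=> X [::]); split=> //.
    by split=> //; split=> [t _|t r c]; [exact: Xs|rewrite onth0n].
  by rewrite /alloc_cost !big_ord0 mulr0 subrr.
(* The regret of [h] is within 1 of the supremum, which is the [+ 1] in the new constant; any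
   continuation can add at most that much regret. *)
have [_ [h [yh [hv yh0 [_ [yhs yhc]] ->]]] hmax] := sup_adherent ltr01 supS.
exists (fun s => X (h ++ s)); split.
- by move=> rs rsv; apply: Xs; rewrite /valid_reqs all_cat; apply/andP.
- move=> rs r c rsv; rewrite -rcons_cat; apply: Xf.
  by rewrite rcons_cat /valid_reqs all_cat; apply/andP.
move=> rs y rsv _ [_ [ys yc]].
(* The comparison path follows [yh] through [h] and joins [y] only at its first step after the
   restart; the state [y 0] itself is skipped. *)
pose m := size h; pose z t := if (t <= m)%N then yh t else y (t - m)%N.
have zr t : z (m + t.+1)%N = y t.+1.
  by rewrite /z ifN ?addKn// -ltnNge; lia.
have zl t : (t <= m)%N -> z t = yh t by move=> tm; rewrite /z tm.
have hrsv : valid_reqs (h ++ rs) by rewrite /valid_reqs all_cat; apply/andP.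
have z0 : z 0%N = X [::] by rewrite zl.
have fz : alloc_offline_feasible (z 0%N) (h ++ rs) z.
  split=> //; split=> [t|t r c].
    rewrite size_cat -/m => tm; rewrite /z; case: ifP => tm'; first exact: yhs.
    by apply: ys; lia.
  rewrite onth_cat -/m; case: ltnP => tm; first by rewrite zl//; exact: yhc.
  have -> : t.+1 = (m + (t - m).+1)%N by lia.
  by rewrite zr; exact: yc.
have : S (alloc_cost w (fun t => X (take t (h ++ rs))) (size (h ++ rs)) -
    rho * alloc_cost w z (size (h ++ rs))) by exists (h ++ rs), z.
move=> /(ub_le_sup supS.2); rewrite size_cat !alloc_cost_cat -/m.
have -> : alloc_cost w z m = alloc_cost w yh m.
  by apply: eq_bigr => t _; rewrite !zl// ltnW.
have -> : alloc_cost w (fun t => X (take t (h ++ rs))) m =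
    alloc_cost w (fun t => X (take t h)) m.
  by apply: eq_bigr => t _; rewrite !takel_cat// ltnW.
have -> : \sum_(t < size rs) move_cost w (X (take (m + t) (h ++ rs)))
      (X (take (m + t).+1 (h ++ rs))) =
    alloc_cost w (fun t => X (h ++ take t rs)) (size rs).
  apply: eq_bigr => t _; rewrite -addnS !take_cat -/m !ltnNge !leq_addr /=.
  by rewrite !addKn.
(* The joining step is bounded by a detour through [y 0], whose first leg costs at most the sum of
   the weights. *)
have hz : \sum_(t < size rs) move_cost w (z (m + t)%N) (z (m + t).+1) <=
    alloc_cost w y (size rs) + \sum_i w i.
  rewrite /alloc_cost; move: ys; case: (size rs) => [|n] ys.
    by rewrite !big_ord0 add0r sumr_ge0.
  rewrite !big_ord_recl /= addn0 -addn1 zr addrAC; apply: lerD; last first.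
    by rewrite le_eqVlt; apply/orP; left; apply/eqP; apply: eq_bigr => t _;
      rewrite -addnS !zr.
  rewrite zl// addrC; apply: le_trans (move_cost_triangle w (y 0%N) _ _ w0) _.
  by rewrite lerD2r; apply: move_cost_simplex => //; [exact: yhs|exact: ys].
move: hmax; rewrite -/m; have := ler_wpM2l rho0 hz; rewrite !mulrDr; lra.
Qed.

Lemma limit_alloc {R : realType} {l : nat} (w : 'I_l -> R) (rho b : R)
    (X : nat -> seq ('I_l * R) -> 'I_l -> R) :
  (forall i, 0 <= w i) ->
  (forall k, near_alloc w rho (4 / k.+1%:R) (fun=> True) b (X k)) ->
  exists X', alloc_competitive w rho X'.
Proof.
move=> w0 HX; have [L mL LN] := @banach_limit R; have [LD LZ Lle Lc] := mL.
pose u s i k := X k s i.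
have Xs s k : valid_reqs s -> in_simplex (X k s) by have [+ _ _] := HX k; apply.
have bu s i : valid_reqs s -> bounded_fct (u s i).
  move=> sv; exists 1 => k; have [/(_ i)/andP[h0 h1] _] := Xs s k sv.
  by rewrite ger0_norm.
pose Y s i := L (u s i).
have Ys s : valid_reqs s -> in_simplex (Y s).
  move=> sv; split=> [i|].
    rewrite -{1}(Lc 0) -(Lc 1); apply/andP.
    have b01 (c : R) : bounded_fct (fun _ : nat => c) := bounded_cst c.
    by split; apply: (Lle _ _ _ _) => //; try exact: bu;
      move=> k; have [/(_ i)/andP[]] := Xs s k sv.
  rewrite -mean_sum//; last by move=> i; exact: bu.
  rewrite (_ : (fun t => _) = fun=> 1) ?Lc//.
  by apply/funext => k; have [_] := Xs s k sv.
have valid_take (rs : seq ('I_l * R)) t : valid_reqs rs -> valid_reqs (take t rs).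
  by move=> /allP rsv; apply/allP => x /mem_take; exact: rsv.
exists Y; split; first split=> //.
  move=> s r c sv c01; have sxv : valid_reqs (rcons s (r, c)).
    by rewrite /valid_reqs all_rcons /= c01.
  rewrite leNgt; apply/negP => Yc; pose e := c - Y (rcons s (r, c)) r.
  have e0 : 0 < e by rewrite subr_gt0.
  have eE : Y (rcons s (r, c)) r = c - e by rewrite /e opprB addrC subrK.
  pose n := Num.truncn (8 / e).
  (* [LN] gives only upper bounds, so it is applied to the negated coordinate. From index [n] on,
     the threshold error is at most [e / 2], which contradicts a violation by [e]. *)
  have : L (fun k => -1 * u (rcons s (r, c)) r k) <= - c + e / 2.
    apply: (LN _ _ n) => [|k nk]; first exact/bounded_scale/bu.
    have [_ /(_ s r c sxv) + _] := HX k; rewrite -/(u _ r k) mulN1r => cu.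
    have ke : 4 / k.+1%:R <= e / 2.
      rewrite ler_pdivrMr ?ltr0n// mulrAC ler_pdivlMr//.
      have : 8 / e <= k.+1%:R.
        by apply: (le_trans (ltW (truncnS_gt _))); rewrite ler_nat.
      by rewrite ler_pdivrMr// mulrC; apply: le_trans; rewrite -natrM.
    apply: (@le_trans _ _ (- c + 4 / k.+1%:R)); last by rewrite lerD2l.
    by rewrite addrC lerNl opprB lerBlDr.
  rewrite LZ; last exact: bu.
  rewrite -[L _]/(Y (rcons s (r, c)) r) eE mulN1r opprB addrC lerD2l.
  by rewrite leNgt gtr_pMr// invf_lt1// ltr1n.
exists b => rs rsv y fy; have y0 := fy.1; rewrite -y0 in fy.
have bu' (t : nat) i : bounded_fct (fun k =>
    w i * `|u (take t.+1 rs) i k - u (take t rs) i k|).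
  by apply: bounded_scale; apply: bounded_norm; apply: bounded_sub;
    exact/bu/valid_take.
apply: (@le_trans _ _ (L (fun k => \sum_(t < size rs) \sum_i
    w i * `|u (take t.+1 rs) i k - u (take t rs) i k|))).
  rewrite mean_sum//; last by move=> t; exact: bounded_sum.
  apply: ler_sum => t _; rewrite mean_sum//; apply: ler_sum => i _.
  rewrite LZ; last by apply: bounded_norm; apply: bounded_sub;
    exact/bu/valid_take.
  by rewrite ler_wpM2l//; apply: mean_dist => //; exact/bu/valid_take.
apply: (LN _ _ 0); first by apply: bounded_sum => t; exact: bounded_sum.
by move=> k _; have [_ _] := HX k; exact.
Qed.

Theorem theorem3 :
  exists c : nat, forall (R : realType) (l : nat) (w : 'I_l -> R)
    (phi : nat -> R),
    (0 < l)%N ->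
    (forall i, 0 < w i) ->
    (forall k : nat, (0 < k)%N -> wimp_competitive k w (phi l)) ->
    exists X : seq ('I_l * R) -> 'I_l -> R,
      alloc_competitive w (c%:R * phi l) X.
Proof.
exists 8 => R l w phi l0 wpos wimp; have w0 i : 0 <= w i by exact: ltW.
have phi0 := competitive_ratio_ge0 w _ l0 wpos (ltn0Sn 0) (wimp 1 (ltn0Sn 0)).
have /choice[X HX] : forall k, exists X, near_alloc w (8 * phi l) (4 / k.+1%:R)
    (fun=> True) (8 * phi l * (\sum_i w i) + 1) X.
  move=> k; have [b [X HX]] :=
    alloc_of_wimp w _ l0 wpos (ltn0Sn k) (wimp _ (ltn0Sn k)).
  by apply: restart_alloc HX => //; rewrite mulr_ge0.
exact: limit_alloc HX.
Qed.
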